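(* Assume the Qualification assumption and that $\bar\alpha(t):=\sum_{(x,y)\in S^2}\alpha(t,x,y)^2>0$ for all $t\in\mathcal T$. Let $r>0$, $\xi\in(0,1)$, $(m^0,w^0)\in\mathcal R$, $(u^0,\gamma^0,P^0)\in\mathcal K$, $(a^0,b^0)\in Q$, and let $(u^k,\gamma^k,P^k,a^k,b^k,m_1^k,w^k)_{k\in\mathbb N}$ be the sequence generated by the ADM-G algorithm with these parameters and this starting point ($m_1^0=m^0$). Let $m_2^k=m_1^k$ and $D^k=\mathbf A w^k$ for all $k$. Then the sequence $(m_1^k,w^k,m_2^k,D^k)_{k\in\mathbb N}$ converges to a solution of $(\mathfrak P)$ and the sequence $(u^k,\gamma^k,P^k)_{k\in\mathbb N}$ converges to a solution of $(D)$.
   Context: Let $T\ge 1$, $n\ge 1$ be integers, $\mathcal T=\{0,\dots,T-1\}$, $\bar{\mathcal T}=\{0,\dots,T\}$, $S=\{0,\dots,n-1\}$. For a finite set $A$, $\mathbb R(A)$ is the space of functions $A\to\mathbb R$ (Euclidean inner product and norm). $\Delta(S)=\{\rho:S\to[0,1]:\sum_{x}\rho(x)=1\}$. Spaces: $\mathcal R=\mathbb R(\bar{\mathcal T}\times S)\times\mathbb R(\mathcal T\times S^2)$, $\mathcal U=\mathbb R(\bar{\mathcal T}\times S)\times\mathbb R(\mathcal T)$, $\mathcal C=\mathcal R\times\mathbb R(\bar{\mathcal T}\times S)\times\mathbb R(\mathcal T)$, $\mathcal K=\mathbb R(\bar{\mathcal T}\times S)\times\mathcal U$. Data: $m_0\in\Delta(S)$,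 $\alpha:\mathcal T\times S^2\to\mathbb R$, $\ell:\mathcal T\times S\times\mathbb R(S)\to\mathbb R\cup\{+\infty\}$, $\phi:\mathcal T\times\mathbb R\to\mathbb R\cup\{+\infty\}$, $F:\bar{\mathcal T}\times\mathbb R(S)\to\mathbb R\cup\{+\infty\}$. Standing assumption: for all $(t,s,x)\in\mathcal T\times\bar{\mathcal T}\times S$ the functions $\ell(t,x,\cdot)$, $F(s,\cdot)$, $\phi(t,\cdot)$ are proper, convex and lower semicontinuous, and $\mathrm{dom}(\ell(t,x,\cdot))\subseteq\Delta(S)$. Fenchel conjugates $\ell^\star,F^\star,\phi^\star$ are in the last variable. Operators: $\mathbf A[w](t)=\sum_{(x,y)\in S^2}w(t,x,y)\alpha(t,x,y)$ with adjoint $\mathbf A^\star[P](t,x,y)=\alpha(t,x,y)P(t)$; $\mathbf S[w](s,x)=\sum_{y\in S}w(s-1,y,x)$ if $s>0$, $\mathbf S[w](0,x)=0$, with adjoint $\mathbf S^\star[u](t,x,y)=u(t+1,y)$. $\bar m_0(0,x)=m_0(x)$, $\bar m_0(s,x)=0$ for $s>0$. Perspective: $\tilde\ell(t,x,\theta,z)=\theta\,\ell(t,x,z/\theta)$ if $\theta>0$; $=0$ if $(\theta,z)=(0,0)$; $=+\infty$ otherwise. Problem $(\mathfrak P)$: minimize $\sum_{(t,x)\in\mathcal T\times S}\tilde\ell(t,x,m_1(t,x),w(t,x,\cdot))+\sum_{t\in\mathcal T}\phi(t,D(t))+\sum_{s\in\bar{\mathcal T}}F(s,m_2(s,\cdot))$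 over $(m_1,w,m_2,D)\in\mathcal C$ subject to $\mathbf S w-m_1+\bar m_0=0$, $m_1=m_2$, $\mathbf A w=D$. Problem $(D)$: maximize $\mathcal D(u,\gamma,P)=\sum_{x}m_0(x)u(0,x)-\sum_{t\in\mathcal T}\phi^\star(t,P(t))-\sum_{s\in\bar{\mathcal T}}F^\star(s,\gamma(s,\cdot))$ over $(u,\gamma,P)\in\mathcal K$ subject to $u(t,x)+\ell^\star(t,x,-\alpha(t,x,\cdot)P(t)-u(t+1,\cdot))\le\gamma(t,x)$ for $(t,x)\in\mathcal T\times S$ and $u(T,\cdot)=\gamma(T,\cdot)$. Let $Q\subseteq\mathcal R$ be the set of $(a,b)$ with $a\in\mathbb R(\bar{\mathcal T}\times S)$, $b\in\mathbb R(\mathcal T\times S^2)$, $\ell^\star(t,x,b(t,x,\cdot))+a(t,x)\le0$ for $(t,x)\in\mathcal T\times S$ and $a(T,x)=0$ for $x\in S$; $\chi_Q$ is its indicator ($0$ on $Q$, $+\infty$ off $Q$). Augmented Lagrangian: $$\mathcal L_r(u,\gamma,P,a,b,m,w)=-\mathcal D(u,\gamma,P)+\chi_Q(a,b)+\langle m,u-\gamma-a\rangle+\langle w,-\mathbf A^\star P-\mathbf S^\star u-b\rangle+\frac r2\big|(u-\gamma-a,\,-\mathbf A^\star P-\mathbf S^\star u-b)\big|^2.$$ ADM-G algorithm. Let $v=(\gamma,P,a,b,m,w)$. Given $(u^k,v^k)$ with $v^k=(\gamma^k,P^k,a^k,b^k,m^k,w^k)$ (the component $m^k$ is denoted $m_1^k$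 in the claim): ADMM step: compute successively $\tilde u\in\arg\min_u\mathcal L_r(u,\gamma^k,P^k,a^k,b^k,m^k,w^k)$; $(\tilde\gamma,\tilde P)\in\arg\min_{(\gamma,P)\in\mathcal U}\mathcal L_r(\tilde u,\gamma,P,a^k,b^k,m^k,w^k)$; $(\tilde a,\tilde b)\in\arg\min_{(a,b)\in Q}\mathcal L_r(\tilde u,\tilde\gamma,\tilde P,a,b,m^k,w^k)$; $(\tilde m,\tilde w)=(m^k,w^k)+r(\tilde u-\tilde\gamma-\tilde a,\,-\mathbf A^\star\tilde P-\mathbf S^\star\tilde u-\tilde b)$; set $\tilde v=(\tilde\gamma,\tilde P,\tilde a,\tilde b,\tilde m,\tilde w)$. Substitution step: $u^{k+1}=\tilde u$ and $v^{k+1}=v^k+\xi\,G(\tilde v-v^k)$, where, with $A_2(\gamma,P)=(-\gamma,-\mathbf A^\star P)$ and $A_3(a,b)=(-a,-b)$ and in the block decomposition $v=((\gamma,P),(a,b),(m,w))$, $$G=\begin{pmatrix}\mathrm{id}&-(A_2^\star A_2)^{-1}A_2^\star A_3&0\\0&\mathrm{id}&0\\0&0&\mathrm{id}\end{pmatrix}.$$ Qualification assumption: there exists $\alpha_0>0$ such that for every $\varepsilon=(\varepsilon_1,\varepsilon_2,\varepsilon_3)\in\mathcal K$ with $\|\varepsilon\|\le\alpha_0$ there exists $\pi:\mathcal T\times S\times S\to\mathbb R$ with $\pi(t,x,\cdot)\in\mathrm{dom}(\ell(t,x,\cdot))$ for all $(t,x)$ such that $m_1[\varepsilon,\pi]\ge0$,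 $m_2[\varepsilon,\pi](s,\cdot)\in\mathrm{dom}(F(s,\cdot))$ for all $s\in\bar{\mathcal T}$, and $D[\varepsilon,\pi](t)\in\mathrm{dom}(\phi(t,\cdot))$ for all $t\in\mathcal T$. Here $m_1=m_1[\varepsilon,\pi]$ solves $m_1(0,x)-\varepsilon_1(0,x)=m_0(x)$, $m_1(t+1,x)=\sum_{y\in S}m_1(t,y)\pi(t,y,x)-\varepsilon_1(t+1,x)$; $m_2[\varepsilon,\pi]=m_1[\varepsilon,\pi]+\varepsilon_2$; $D[\varepsilon,\pi](t)=\sum_{(x,y)\in S^2}m_1[\varepsilon,\pi](t,x)\pi(t,x,y)\alpha(t,x,y)+\varepsilon_3(t)$.
   Formalization: In the u-step, the argmin is taken of the part of the augmented Lagrangian that depends on u; the terms constant in u (φ*(P^k), F*(γ^k), χ_Q(a^k,b^k)) are dropped, since they may be +∞ and the literal argmin would then be arbitrary or empty. *)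

(* Defs.v *)
From HB Require Import structures.
From mathcomp Require Import all_boot all_order all_algebra.
From mathcomp Require Import all_classical all_reals all_analysis.
From mathcomp Require Import ring lra.
Set Implicit Arguments.
Unset Strict Implicit.
Unset Printing Implicit Defensive.
Import Order.TTheory GRing.Theory Num.Theory.
Import numFieldNormedType.Exports.
Local Open Scope classical_set_scope.
Local Open Scope ring_scope.

(* fspace R A is the space R(A) of functions A -> R. It is made a normed      *)
(* module with the Euclidean norm, so that [`|f|], [lower_semicontinuous] and *)
(* [-->] below are the library's notions for that norm.                       *)
Definition fspace (R : realType) (A : finType) : Type := {ffun A -> R}.

HB.instance Definition _ (R : realType) (A : finType) :=
  GRing.Lmodule.copy (fspace R A) {ffun A -> R^o}.

Definition dot (R : realType) (A : finType) (f g : fspace R A) : R :=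
  \sum_i f i * g i.

Definition enorm (R : realType) (A : finType) (f : fspace R A) : R :=
  Num.sqrt (dot f f).

Section Euclidean.
Variables (R : realType) (A : finType).
Implicit Types f g : fspace R A.

Lemma dot_ge0 f : 0 <= dot f f.
Proof. by apply: sumr_ge0 => i _; rewrite -expr2 sqr_ge0. Qed.

Lemma enorm_eq0 f : enorm f = 0 -> f = 0.
Proof.
move/eqP; rewrite sqrtr_eq0 => le0.
have /eqP : dot f f = 0 by apply/eqP; rewrite eq_le le0 dot_ge0.
rewrite psumr_eq0 => [/allP f0|i _]; last by rewrite -expr2 sqr_ge0.
apply/ffunP => i; rewrite [RHS]ffunE.
by have := f0 i (mem_index_enum i); rewrite /= mulf_eq0 orbb => /eqP.
Qed.

Lemma enormZ (l : R) f : enorm (l *: f) = `|l| * enorm f.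
Proof.
rewrite /enorm -sqrtr_sqr -sqrtrM ?sqr_ge0//; congr Num.sqrt.
by rewrite /dot mulr_sumr; apply: eq_bigr => i _; rewrite ffunE /GRing.scale/=; ring.
Qed.

Lemma dotD f g : dot (f + g) (f + g) = dot f f + 2 * dot f g + dot g g.
Proof.
rewrite /dot mulr_sumr -!big_split/=.
by apply: eq_bigr => i _; rewrite !ffunE; ring.
Qed.

Lemma dotZDZ (s t : R) f g :
  dot (s *: f + t *: g) (s *: f + t *: g) =
  s ^+ 2 * dot f f + 2 * s * t * dot f g + t ^+ 2 * dot g g.
Proof.
rewrite /dot !mulr_sumr -!big_split/=.
by apply: eq_bigr => i _; rewrite !ffunE /GRing.scale/=; ring.
Qed.

Lemma dot_le_enorm f g : dot f g <= enorm f * enorm g.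
Proof.
have [/enorm_eq0 ->|f0] := eqVneq (enorm f) 0.
  rewrite /dot big1 => [|i _]; last by rewrite ffunE mul0r.
  by rewrite mulr_ge0 ?sqrtr_ge0.
have [/enorm_eq0 ->|g0] := eqVneq (enorm g) 0.
  rewrite /dot big1 => [|i _]; last by rewrite ffunE mulr0.
  by rewrite mulr_ge0 ?sqrtr_ge0.
have fp : 0 < enorm f by rewrite lt_neqAle eq_sym f0 sqrtr_ge0.
have gp : 0 < enorm g by rewrite lt_neqAle eq_sym g0 sqrtr_ge0.
have := dot_ge0 (enorm g *: f + (- enorm f) *: g).
rewrite dotZDZ -[dot f f]sqr_sqrtr ?dot_ge0// -[dot g g]sqr_sqrtr ?dot_ge0//.
rewrite -/(enorm f) -/(enorm g) => h.
have /mulr_gt0/(_ gp) := fp.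
nra.
Qed.

Lemma ler_enormD f g : enorm (f + g) <= enorm f + enorm g.
Proof.
rewrite -(@ler_pXn2r _ 2)// ?nnegrE ?addr_ge0 ?sqrtr_ge0//.
rewrite sqr_sqrtr ?dot_ge0// dotD sqrrD !sqr_sqrtr ?dot_ge0//.
by have := dot_le_enorm f g; rewrite -/(enorm f) -/(enorm g); lra.
Qed.

End Euclidean.

HB.instance Definition _ (R : realType) (A : finType) :=
  @Lmodule_isNormed.Build R (fspace R A) (@enorm R A)
    (@ler_enormD R A) (@enormZ R A) (@enorm_eq0 R A).

Lemma normE (R : realType) (A : finType) (f : fspace R A) :
  `|f| = Num.sqrt (dot f f).
Proof. by []. Qed.

(* Convex analysis in an arbitrary normed module. Functions with values in     *)
(* R \cup {+oo} are functions to \bar R that are proper, hence never -oo.      *)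
Section ConvexAnalysis.
Variables (R : realType) (V : normedModType R).
Implicit Types f : V -> \bar R.

Definition edom f : set V := [set x | (f x < +oo)%E].

Definition eproper f := (forall x, f x != -oo%E) /\ edom f !=set0.

Definition econvex f := forall (x y : V) (s : R), 0 <= s <= 1 ->
  (f (s *: x + (1 - s) *: y)%R <= s%:E * f x + (1 - s)%:E * f y)%E.

Definition proper_convex_lsc f :=
  [/\ eproper f, econvex f & lower_semicontinuous f].

(* Fenchel conjugate with respect to the pairing ip. *)
Definition fenchel (ip : V -> V -> R) f (p : V) : \bar R :=
  ereal_sup [set ((ip p z)%:E - f z)%E | z in [set: V]].

Definition argmin_on (X : set V) f : set V :=
  [set x | X x /\ forall y, X y -> (f x <= f y)%E].

End ConvexAnalysis.

Definition simplex (R : realType) (A : finType) : set (fspace R A) :=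
  [set rho | (forall x, 0 <= rho x <= 1) /\ \sum_x rho x = 1].

(* T time steps and n states: t : 'I_T, s : 'I_T.+1, x y : 'I_n. *)
Notation spaceTbS R T n := (fspace R ('I_T.+1 * 'I_n)%type).
Notation spaceTSS R T n := (fspace R ('I_T * 'I_n * 'I_n)%type).
Notation spaceT R T := (fspace R 'I_T).
Notation spaceS R n := (fspace R 'I_n).
Notation spaceR R T n := (spaceTbS R T n * spaceTSS R T n)%type.
Notation spaceU R T n := (spaceTbS R T n * spaceT R T)%type.
Notation spaceC R T n := (spaceR R T n * spaceTbS R T n * spaceT R T)%type.
Notation spaceK R T n := (spaceTbS R T n * spaceU R T n)%type.
(* v = ((gamma, P), (a, b), (m, w)) *)
Notation spaceV R T n :=
  (spaceU R T n * spaceR R T n * spaceR R T n)%type.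

Record mfc_data (R : realType) (T n : nat) := MfcData {
  m0 : spaceS R n;
  alpha : spaceTSS R T n;
  ell : 'I_T -> 'I_n -> spaceS R n -> \bar R;
  phi : 'I_T -> R^o -> \bar R;
  costF : 'I_T.+1 -> spaceS R n -> \bar R
}.

Section Model.
Variables (R : realType) (T n : nat) (d : mfc_data R T n).

Definition standing_assumption :=
  [/\ simplex (m0 d),
      (forall t x, proper_convex_lsc (ell d t x) /\
                   edom (ell d t x) `<=` @simplex R 'I_n),
      (forall t, proper_convex_lsc (phi d t)) &
      (forall s, proper_convex_lsc (costF d s))].

Definition ell_conj t x := fenchel (@dot R 'I_n) (ell d t x).
Definition phi_conj t := fenchel (fun p z : R^o => p * z) (phi d t).
Definition costF_conj s := fenchel (@dot R 'I_n) (costF d s).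

(* A time t : 'I_T seen in 'I_T.+1, and its successor t + 1. *)
Definition time_cur (t : 'I_T) : 'I_T.+1 := widen_ord (leqnSn T) t.
Definition time_succ (t : 'I_T) : 'I_T.+1 := lift ord0 t.

(* f(s, .) and w(t, x, .) *)
Definition at_time (f : spaceTbS R T n) (s : 'I_T.+1) : spaceS R n :=
  [ffun x => f (s, x)].
Definition at_state (w : spaceTSS R T n) (t : 'I_T) (x : 'I_n) : spaceS R n :=
  [ffun y => w (t, x, y)].

Definition opA (w : spaceTSS R T n) : spaceT R T :=
  [ffun t => \sum_x \sum_y w (t, x, y) * alpha d (t, x, y)].
Definition opA_adj (P : spaceT R T) : spaceTSS R T n :=
  [ffun i => alpha d i * P i.1.1].
(* [unlift ord0 s] is [None] if s = 0 and [Some t] if s = t + 1. *)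
Definition opS (w : spaceTSS R T n) : spaceTbS R T n :=
  [ffun i => if unlift ord0 i.1 is Some t then \sum_y w (t, y, i.2) else 0].
Definition opS_adj (u : spaceTbS R T n) : spaceTSS R T n :=
  [ffun i => u (time_succ i.1.1, i.2)].

Definition bar_m0 : spaceTbS R T n :=
  [ffun i => if i.1 == ord0 then m0 d i.2 else 0].

Definition bar_alpha (t : 'I_T) : R := \sum_x \sum_y alpha d (t, x, y) ^+ 2.

Definition perspective (t : 'I_T) (x : 'I_n) (theta : R) (z : spaceS R n)
    : \bar R :=
  if 0 < theta then (theta%:E * ell d t x (theta^-1 *: z)%R)%E
  else if (theta == 0) && (z == 0) then 0%E else +oo%E.

Definition primal_cost (z : spaceC R T n) : \bar R :=
  let: (m1, w, m2, D) := z in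
  (\sum_t \sum_x perspective t x (m1 (time_cur t, x)) (at_state w t x)
   + \sum_t phi d t (D t) + \sum_s costF d s (at_time m2 s))%E.

Definition primal_feasible : set (spaceC R T n) :=
  [set z : spaceC R T n | let: (m1, w, m2, D) := z in
           [/\ opS w - m1 + bar_m0 = 0, m1 = m2 & opA w = D]].

Definition primal_solution (z : spaceC R T n) :=
  primal_feasible z /\
  forall z', primal_feasible z' -> (primal_cost z <= primal_cost z')%E.

Definition dual_value (z : spaceK R T n) : \bar R :=
  let: (u, (gamma, P)) := z in
  ((\sum_x m0 d x * u (ord0, x))%:E - \sum_t phi_conj t (P t)
   - \sum_s costF_conj s (at_time gamma s))%E.

Definition dual_feasible : set (spaceK R T n) :=
  [set z : spaceK R T n | let: (u, (gamma, P)) := z in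
    (forall t x,
       ((u (time_cur t, x))%:E
        + ell_conj t x (- (P t *: at_state (alpha d) t x) - at_time u (time_succ t))%R
        <= (gamma (time_cur t, x))%:E)%E) /\
    at_time u ord_max = at_time gamma ord_max].

Definition dual_solution (z : spaceK R T n) :=
  dual_feasible z /\
  forall z', dual_feasible z' -> (dual_value z' <= dual_value z)%E.

Definition setQ : set (spaceR R T n) :=
  [set ab : spaceR R T n |
    (forall t x, (ell_conj t x (at_state ab.2 t x) + (ab.1 (time_cur t, x))%:E
                    <= 0)%E) /\
    (forall x, ab.1 (ord_max, x) = 0)].

Definition indicator (X : set (spaceR R T n)) (p : spaceR R T n) : \bar R :=
  if p \in X then 0%E else +oo%E.

(* The norm which the library puts on a product is the maximum of the norms;  *)
(* the Euclidean inner product and norms of the product spaces are as follows. *)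
Definition dotR (p q : spaceR R T n) : R := dot p.1 q.1 + dot p.2 q.2.
Definition enormR (p : spaceR R T n) : R := Num.sqrt (dotR p p).
Definition enormK (z : spaceK R T n) : R :=
  Num.sqrt (dot z.1 z.1 + dot z.2.1 z.2.1 + dot z.2.2 z.2.2).

(* (u - gamma - a, - A^* P - S^* u - b) *)
Definition residual (u : spaceTbS R T n) (gP : spaceU R T n)
    (ab : spaceR R T n) : spaceR R T n :=
  (u - gP.1 - ab.1, - opA_adj gP.2 - opS_adj u - ab.2).

Definition aug_lagrangian (r : R) (u : spaceTbS R T n) (gP : spaceU R T n)
    (ab mw : spaceR R T n) : \bar R :=
  (- dual_value (u, gP) + indicator setQ ab
   + (dot mw.1 (residual u gP ab).1)%:E + (dot mw.2 (residual u gP ab).2)%:E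
   + (r / 2 * enormR (residual u gP ab) ^+ 2)%:E)%E.

(* The terms of aug_lagrangian that depend on u. The remaining ones, phi^*(P), *)
(* F^*(gamma) and chi_Q(a, b), are constants for the minimization over u, but  *)
(* possibly +oo ones: nothing keeps the iterates gamma^k and P^k in the        *)
(* domains of F^* and phi^*. The minimization over u is that of aug_lagrangian *)
(* up to these constants, see argmin_aug_lagrangian_u.                         *)
Definition aug_lagrangian_u (r : R) (u : spaceTbS R T n) (gP : spaceU R T n)
    (ab mw : spaceR R T n) : R :=
  - (\sum_x m0 d x * u (ord0, x)) + dot mw.1 (residual u gP ab).1
  + dot mw.2 (residual u gP ab).2 + r / 2 * enormR (residual u gP ab) ^+ 2.

Definition A2 (gP : spaceU R T n) : spaceR R T n := (- gP.1, - opA_adj gP.2).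
Definition A2_adj (p : spaceR R T n) : spaceU R T n := (- p.1, - opA p.2).
Definition A3 (ab : spaceR R T n) : spaceR R T n := (- ab.1, - ab.2).

(* 'pinv is the inverse of A2^* A2, which is bijective when bar_alpha > 0, see *)
(* A2_adj_A2_bij.                                                              *)
Definition opG (v : spaceV R T n) : spaceV R T n :=
  let: (gP, ab, mw) := v in
  (gP - 'pinv_(fun=> 0) setT (A2_adj \o A2) (A2_adj (A3 ab)), ab, mw).

Definition admm_step (r : R) (v : spaceV R T n)
    (ut : spaceTbS R T n) (vt : spaceV R T n) : Prop :=
  let: (gP, ab, mw) := v in
  let: (gPt, abt, mwt) := vt in
  [/\ argmin_on setT (fun u' => (aug_lagrangian_u r u' gP ab mw)%:E) ut,
      argmin_on setT (fun gP' => aug_lagrangian r ut gP' ab mw) gPt,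
      argmin_on setQ (fun ab' => aug_lagrangian r ut gPt ab' mw) abt &
      mwt = mw + r *: residual ut gPt abt].

Definition admg_step (r xi : R) (v : spaceV R T n)
    (u' : spaceTbS R T n) (v' : spaceV R T n) : Prop :=
  exists ut vt, [/\ admm_step r v ut vt, u' = ut & v' = v + xi *: opG (vt - v)].

(* The perturbed state equation solved by m_1[eps, pi]. *)
Definition state_equation (eps1 m1 : spaceTbS R T n) (pi : spaceTSS R T n) :=
  (forall x, m1 (ord0, x) - eps1 (ord0, x) = m0 d x) /\
  (forall t x, m1 (time_succ t, x)
     = \sum_y m1 (time_cur t, y) * pi (t, y, x) - eps1 (time_succ t, x)).

Definition qualification :=
  exists2 alpha0 : R, 0 < alpha0 &
  forall eps : spaceK R T n, enormK eps <= alpha0 ->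
  let: (eps1, (eps2, eps3)) := eps in
  exists (pi : spaceTSS R T n) (m1 m2 : spaceTbS R T n) (D : spaceT R T),
    [/\ forall t x, edom (ell d t x) (at_state pi t x),
        state_equation eps1 m1 pi,
        m2 = m1 + eps2,
        (forall t, D t = \sum_x \sum_y
             m1 (time_cur t, x) * pi (t, x, y) * alpha d (t, x, y) + eps3 t)
      & [/\ forall i, 0 <= m1 i,
            forall s, edom (costF d s) (at_time m2 s)
          & forall t, edom (phi d t) (D t)]].

Lemma A2_adj_A2_bij : (forall t, 0 < bar_alpha t) -> bijective (A2_adj \o A2).
Proof.
move=> pos.
have A2E gP : (A2_adj \o A2) gP = (gP.1, [ffun t => bar_alpha t * gP.2 t]).
  rewrite /A2_adj/A2/= opprK; congr pair; apply/ffunP => t.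
  rewrite !ffunE /bar_alpha -sumrN mulr_suml; apply: eq_bigr => x _.
  rewrite -sumrN mulr_suml; apply: eq_bigr => y _; rewrite !ffunE/=.
  by ring.
exists (fun gP : spaceU R T n =>
  (gP.1, [ffun t => (bar_alpha t)^-1 * gP.2 t]) : spaceU R T n) => -[g p];
  rewrite A2E/=; congr pair; apply/ffunP => t; rewrite !ffunE.
- by rewrite mulKf// gt_eqF.
- by rewrite mulVKf// gt_eqF.
Qed.

Lemma argmin_aug_lagrangian_u r (gP : spaceU R T n) (ab mw : spaceR R T n) :
  (forall t, phi_conj t (gP.2 t) \is a fin_num) ->
  (forall s, costF_conj s (at_time gP.1 s) \is a fin_num) -> setQ ab ->
  argmin_on setT (fun u => aug_lagrangian r u gP ab mw)
  = argmin_on setT (fun u => (aug_lagrangian_u r u gP ab mw)%:E).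
Proof.
move=> phi_fin F_fin Qab.
have /fineK phiE : (\sum_t phi_conj t (gP.2 t))%E \is a fin_num.
  by apply/sum_fin_numP => t _ _; exact: phi_fin.
have /fineK FE : (\sum_s costF_conj s (at_time gP.1 s))%E \is a fin_num.
  by apply/sum_fin_numP => s _ _; exact: F_fin.
have LE u : aug_lagrangian r u gP ab mw = ((aug_lagrangian_u r u gP ab mw)%:E
    + (fine (\sum_t phi_conj t (gP.2 t))%E
       + fine (\sum_s costF_conj s (at_time gP.1 s))%E)%:E)%E.
  rewrite /aug_lagrangian /dual_value; case: gP phi_fin F_fin phiE FE => g p/= _ _.
  move=> <- <-; rewrite /indicator mem_set// /aug_lagrangian_u adde0.
  by rewrite -!EFinB -EFinN -!EFinD; congr EFin => /=; ring.
apply/seteqP; split => u' [_ min]; split => // y _; have := min y I;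
  by rewrite !LE leeD2rE.
Qed.

End Model.

(* Main.v *)
Require Import Defs.
From mathcomp Require Import all_boot all_order all_algebra.
From mathcomp Require Import all_classical all_reals all_analysis.
From mathcomp Require Import ring lra.
Import Order.TTheory GRing.Theory Num.Theory.
Import numFieldNormedType.Exports.
Local Open Scope classical_set_scope.
Local Open Scope ring_scope.

(** Write A x = A1 u + A2 (gamma, P) + A3 (a, b) for the residual of
    x = (u, (gamma, P), (a, b)), where A1 u = (u, - S^* u).  Problem (D)
    minimizes the convex function
      f x = - <bar m0, u> + sum phi^* (P) + sum F^* (gamma) + chi_Q (a, b)
    under A x = 0, and (P) is its Lagrangian dual: the multiplier l = (m, w) of
    A x = 0 is the primal unknown.  Everything goes through the saddle points
    (x, l) of the Lagrangian, characterized block by block ([optimality],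
    [saddle]).

    A saddle point solves both problems.  For (D) this is the usual computation
    ([saddle_dual_solution]).  For (P), minimality in (gamma, P) and in (a, b)
    separates into one condition per time or per pair (t, x), which turns the
    Fenchel-Young inequalities used in weak duality into equalities; this is
    where phi, F and ell must equal their biconjugates
    ([saddle_primal_solution]).  The Fenchel-Moreau theorem is obtained from a
    Lagrange multiplier theorem for finitely many affine constraints, itself
    proved one constraint at a time ([multipliers]), applied to a penalized
    function ([affine_minorant]).

    Saddle points exist.  Weak duality between (D) and the primal problem
    perturbed by +- a multiple of the i-th unit vector bounds the i-th
    coordinate of (u, gamma, P) on the sublevel sets of (D); the qualification
    assumption says that these perturbed problems have a finite value, so (D)
    attains its minimum ([dual_attained]).  Each ell(t, x, .) has a bounded
    domain, so its conjugate is finite everywhere, and A maps the domain of f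
    onto the whole residual space (solve backward in time); hence the minimum
    of (D) has a multiplier ([saddle_exists]).

    Convergence.  The ADMM prediction satisfies the optimality conditions of a
    saddle point with the multiplier shifted by - r (A2 dx2 + A3 dx3) in the u
    block and by - r A3 dx3 in the (gamma, P) block ([admm_step_optimality]).
    The linear map G is diagonalized by the change of unknown
    y = (gamma, P) + (A2^* A2)^-1 A2^* A3 (a, b): in the unknowns (y, (a, b), l)
    the correction adds xi times the prediction step ([shear_step]).
    Monotonicity of the optimality conditions then shows that the distance
      r^2 |A2 (y - y')|^2 + r^2 |A3 (x3 - x3')|^2 + |l - l'|^2
    to any saddle point decreases by at least xi (1 - xi) times the same
    quadratic form of the step ([admg_descent], [admm_step_fejer]).  So the
    steps tend to 0, every cluster point is a saddle point since the optimality
    conditions are closed ([limit_saddle]), and a Fejer monotone sequence whose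
    cluster points all are targets converges ([fejer_cvg]). *)

Set Implicit Arguments.
Unset Strict Implicit.
Unset Printing Implicit Defensive.

(** * Lagrange multipliers and affine minorants *)

Section Multipliers.
Variables (R : realType) (X : lmodType R).

Definition convex_set_on (D : set X) := forall x y (s : R),
  D x -> D y -> 0 <= s <= 1 -> D (s *: x + (1 - s) *: y).

Definition convex_fun_on (D : set X) (f : X -> R) := forall x y (s : R),
  D x -> D y -> 0 <= s <= 1 ->
  f (s *: x + (1 - s) *: y) <= s * f x + (1 - s) * f y.

Definition affine_fun_on (D : set X) (g : X -> R) := forall x y (s : R),
  D x -> D y -> 0 <= s <= 1 ->
  g (s *: x + (1 - s) *: y) = s * g x + (1 - s) * g y.

(** A multiplier l must lie above (c - f x) / g x wherever g x > 0 and below it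
    wherever g x < 0.  The convex combination of two such points at which g
    vanishes shows that these bounds are compatible, and the supremum of the
    former is a multiplier. *)
Lemma single_multiplier (D : set X) (f g : X -> R) (c : R) :
  convex_set_on D -> convex_fun_on D f -> affine_fun_on D g ->
  (exists2 x, D x & 0 < g x) -> (exists2 x, D x & g x < 0) ->
  (forall x, D x -> g x = 0 -> c <= f x) ->
  exists l : R, forall x, D x -> c <= f x + l * g x.
Proof.
move=> Dc fc ga [xp Dxp gxp] [xn Dxn gxn] fmin.
have key x y : D x -> D y -> 0 < g x -> g y < 0 ->
    (c - f x) / g x <= (c - f y) / g y.
  move=> Dx Dy gx gy.
  have gxy : 0 < g x - g y by lra.
  (* s *: x + (1 - s) *: y is the point of the segment where g vanishes *)
  pose s := - g y / (g x - g y).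
  have s01 : 0 <= s <= 1.
    apply/andP; split; first by rewrite divr_ge0 ?oppr_ge0// ltW.
    by rewrite ler_pdivrMr// mul1r; lra.
  have sE : s * (g x - g y) = - g y by rewrite /s mulfVK// gt_eqF.
  have : c <= f (s *: x + (1 - s) *: y).
    by apply: fmin; [exact: Dc | rewrite ga//; lra].
  move=> /le_trans/(_ (fc _ _ _ Dx Dy s01)) cs.
  have cs' : c * (g x - g y) <= - g y * f x + g x * f y.
    rewrite (_ : _ + _ = (s * f x + (1 - s) * f y) * (g x - g y)).
      by rewrite ler_pM2r.
    by rewrite mulrDl mulrAC sE mulrBl mul1r mulrBl mulrAC sE; ring.
  rewrite ler_ndivlMr//.
  rewrite mulrAC ler_pdivlMr//; lra.
pose B := [set (c - f x) / g x | x in [set x | D x /\ 0 < g x]].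
have Bub y : D y -> g y < 0 -> ubound B ((c - f y) / g y).
  by move=> Dy gy _ [x [Dx gx] <-]; exact: key.
have Bsup : has_sup B.
  split; first by exists ((c - f xp) / g xp), xp.
  by exists ((c - f xn) / g xn); exact: Bub.
exists (sup B) => x Dx.
have [gx|gx|gx] := ltgtP (g x) 0.
- have : sup B <= (c - f x) / g x by apply: ge_sup; [exact: Bsup.1 | exact: Bub].
  by rewrite ler_ndivlMr//; lra.
- have : (c - f x) / g x <= sup B.
    by apply: ub_le_sup; [exact: Bsup.2 | exists x].
  by rewrite ler_pdivrMr//; lra.
- by rewrite gx mulr0 addr0; exact: fmin.
Qed.

(** Constraints are relaxed one at a time: on the set where the others hold, the
    surjectivity of g provides the two points that [single_multiplier] needs. *)
Lemma multipliers (J : finType) (D : set X) (f : X -> R) (g : X -> J -> R)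
    (c : R) :
  convex_set_on D -> convex_fun_on D f ->
  (forall j, affine_fun_on D (g^~ j)) ->
  (forall h : J -> R, exists2 x, D x & forall j, g x j = h j) ->
  (forall x, D x -> (forall j, g x j = 0) -> c <= f x) ->
  exists l : J -> R, forall x, D x -> c <= f x + \sum_j l j * g x j.
Proof.
move=> Dc fc ga gsurj fmin.
suff [l lP] : exists l : J -> R, forall x, D x ->
    c <= f x + \sum_(j <- enum J) l j * g x j.
  by exists l => x /lP; rewrite big_enum.
have : forall x, D x -> (forall j, j \in enum J -> g x j = 0) -> c <= f x.
  by move=> x Dx gx; apply: fmin => // j; apply: gx; rewrite mem_enum.
elim: (enum J) (enum_uniq J) f fc {fmin} =>
    [_ f _ fmin|i s IHs /= /andP[is_ us] f fc fmin].
  by exists (fun=> 0) => x Dx; rewrite big_nil addr0; exact: fmin.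
pose D' := [set x | D x /\ forall j, j \in s -> g x j = 0].
have D'c : convex_set_on D'.
  move=> x y t [Dx gx] [Dy gy] t01; split; first exact: Dc.
  by move=> j js; rewrite ga// gx// gy// !mulr0 addr0.
have D'D x : D' x -> D x by case.
have pt (e : R) : exists2 x, D' x & g x i = e.
  have [x Dx gx] := gsurj (fun j => if j == i then e else 0).
  exists x; last by rewrite gx eqxx.
  split=> // j js; rewrite gx ifF//; apply/negbTE/eqP => ji.
  by move: is_; rewrite -ji js.
have [|||||l0 l0P] := @single_multiplier D' f (g^~ i) c D'c.
- by move=> x y t /D'D Dx /D'D Dy; exact: fc.
- by move=> x y t /D'D Dx /D'D Dy; exact: ga.
- by have [x D'x gx] := pt 1; exists x => //; rewrite gx.
- by have [x D'x gx] := pt (-1); exists x => //; rewrite gx ltrN10.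
- move=> x [Dx gx] gxi; apply: fmin => // j.
  by rewrite inE => /orP[/eqP->//|/gx].
have [||l lP] := IHs us (fun x => f x + l0 * g x i).
- move=> x y t Dx Dy t01; rewrite ga//.
  by have := fc _ _ _ Dx Dy t01; lra.
- by move=> x Dx gx; exact: l0P.
exists (fun j => if j == i then l0 else l j) => x Dx.
rewrite big_cons eqxx addrA (eq_big_seq (fun j => l j * g x j)).
  exact: lP.
move=> j js; rewrite ifF//; apply/negbTE/eqP => ji.
by move: is_; rewrite -ji js.
Qed.

End Multipliers.

Section Duality.
Variables (R : realType) (V : normedModType R).
Implicit Types f : V -> \bar R.

Lemma eproper_fineE f z : eproper f -> edom f z -> f z = (fine (f z))%:E.
Proof.
by move=> [fN _] fz; rewrite fineK// fin_real// ltNye fN.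
Qed.

Lemma edom_convex f : eproper f -> econvex f ->
  convex_set_on (edom f) /\ convex_fun_on (edom f) (fine \o f).
Proof.
move=> fp fc; suff H x y (s : R) : edom f x -> edom f y -> 0 <= s <= 1 ->
    (f (s *: x + (1 - s) *: y)%R
       <= (s * fine (f x) + (1 - s) * fine (f y))%R%:E)%E.
  have D : convex_set_on (edom f).
    by move=> x y s fx fy s01; rewrite /edom/= (le_lt_trans (H _ _ _ fx fy s01)) ?ltry.
  split=> // x y s fx fy s01 /=; have := H _ _ _ fx fy s01.
  by rewrite (eproper_fineE fp (D _ _ _ fx fy s01)) lee_fin.
move=> fx fy s01; have := fc x y s s01.
by rewrite {1}(eproper_fineE fp fx) {1}(eproper_fineE fp fy) -!EFinM -EFinD.
Qed.

(** Near a point y0 of its domain f is bounded below; farther away convexity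
    along the segment to y0 propagates this bound with a linear loss. *)
Lemma convex_lsc_lower_bound f : proper_convex_lsc f ->
  exists y0, exists K B : R,
    forall y, edom f y -> B - K * `|y - y0| <= fine (f y).
Proof.
move=> [fp fc fl]; have [_ [y0 fy0]] := fp.
have [Dc Fc] := edom_convex fp fc.
have lt0 : ((fine (f y0) - 1)%R%:E < f y0)%E.
  by rewrite [ltRHS](eproper_fineE fp fy0) lte_fin; lra.
have [U /nbhs_normP[e /= e0 eU] Uf] := fl _ _ lt0.
exists y0, (2 / e), (fine (f y0) - 1) => y fy.
have [ye|ye] := ltP `|y - y0| e.
  have : U y by apply: eU; rewrite /ball_/= distrC.
  move=> /Uf; rewrite (eproper_fineE fp fy) lte_fin => h.
  by rewrite (le_trans _ (ltW h))// lerBlDr lerDl mulr_ge0// divr_ge0// ltW.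
have d0 : 0 < `|y - y0| by apply: lt_le_trans ye.
pose s := e / 2 / `|y - y0|.
have sE : s * `|y - y0| = e / 2 by rewrite /s mulfVK// gt_eqF.
have s0 : 0 < s by rewrite /s !divr_gt0.
have s01 : 0 <= s <= 1 by rewrite ltW//= /s ler_pdivrMr// mul1r; lra.
have : U (s *: y + (1 - s) *: y0).
  apply: eU; rewrite /ball_/= (_ : _ - _ = - (s *: (y - y0))).
    by rewrite normrN normrZ gtr0_norm// sE; lra.
  by rewrite scalerBl scale1r scalerBr !opprD !opprK addrCA; congr (_ + _); rewrite addrA subrr add0r.
move=> /Uf; rewrite (eproper_fineE fp (Dc _ _ _ fy fy0 s01)) lte_fin => h.
have {}h := lt_le_trans h (Fc _ _ _ fy fy0 s01); rewrite /= in h.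
have : -1 < s * (fine (f y) - fine (f y0)) by lra.
rewrite -ltr_pdivrMl// mulrN1.
have -> : s^-1 = 2 / e * `|y - y0|.
  by rewrite /s invf_div invf_div mulrC.
by move=> h'; lra.
Qed.

(** A steep enough cone with vertex (z0, c) lies below f: close to z0 by lower
    semicontinuity, far from it by [convex_lsc_lower_bound]. *)
Lemma convex_lsc_penalty f z0 (c : R) : proper_convex_lsc f ->
  (c%:E < f z0)%E ->
  exists2 K : R, 0 <= K &
    forall y, edom f y -> c <= fine (f y) + K * `|y - z0|.
Proof.
move=> fpcl cf; have [fp fc fl] := fpcl.
have [y0 [K [B KB]]] := convex_lsc_lower_bound fpcl.
have [U /nbhs_normP[e /= e0 eU] Uf] := fl _ _ cf.
pose E := `|c - B + `|K| * `|z0 - y0| |.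
have KE0 : 0 <= `|K| + E / e by apply: addr_ge0 => //; apply: divr_ge0; [exact: normr_ge0 | exact: ltW].
exists (`|K| + E / e) => //.
move=> y fy; have [ye|ye] := ltP `|y - z0| e.
  have : U y by apply: eU; rewrite /ball_/= distrC.
  move=> /Uf; rewrite (eproper_fineE fp fy) lte_fin => h.
  by rewrite (le_trans (ltW h))// lerDl mulr_ge0.
have := KB _ fy.
have : K * `|y - y0| <= `|K| * (`|y - z0| + `|z0 - y0|).
  apply: (@le_trans _ _ (`|K| * `|y - y0|)).
    by rewrite ler_wpM2r// ler_norm.
  by rewrite ler_wpM2l// ler_distD.
have : E <= E / e * `|y - z0|.
  by rewrite mulrAC ler_pdivlMr// ler_wpM2l// /E normr_ge0.
have : c - B + `|K| * `|z0 - y0| <= E by exact: ler_norm.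
by lra.
Qed.

(** The form in which a lower semicontinuous convex function is the supremum of
    its affine minorants.  The coordinates co allow V to be both a space of
    functions and the real line. *)
Lemma affine_minorant (J : finType) (co : V -> J -> R) f z0 (c : R) :
  (forall s x y j, co (s *: x + y) j = s * co x j + co y j) ->
  (forall h : J -> R, exists x, forall j, co x j = h j) ->
  (forall x, (forall j, co x j = 0) -> x = 0) ->
  proper_convex_lsc f -> (c%:E < f z0)%E ->
  exists l : J -> R, forall y,
    ((c + \sum_j l j * (co y j - co z0 j))%R%:E <= f y)%E.
Proof.
move=> colin cosurj coinj fpcl cf; have [fp fc _] := fpcl.
have [K K0 KP] := convex_lsc_penalty fpcl cf.
have [Dc Fc] := edom_convex fp fc.
have co0 j : co 0 j = 0.
  by have := colin 1 0 0 j; rewrite scaler0 addr0; lra.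
have coZ s x j : co (s *: x) j = s * co x j.
  by have := colin s x 0 j; rewrite !addr0 co0 addr0.
(* Minimize f y + K |y - (z0 + h)| over (h, y) under h = 0.  The multiplier l
   gives c <= f y + K |y - (z0 + h)| + l . h for all h; take h = y - z0. *)
pose D := [set x : V * V | edom f x.2].
pose F (x : V * V) := fine (f x.2) + K * `|x.2 - (z0 + x.1)|.
have [|||||l lP] := @multipliers R (V * V)%type J D F (fun x => co x.1) c.
- by move=> x y s; exact: Dc.
- move=> x y s Dx Dy s01; have := Fc _ _ _ Dx Dy s01.
  have -> : F (s *: x + (1 - s) *: y) = (fine \o f) (s *: x.2 + (1 - s) *: y.2)
     + K * `|s *: (x.2 - (z0 + x.1)) + (1 - s) *: (y.2 - (z0 + y.1))|.
    rewrite /F; congr (_ + K * `| _ |); rewrite /=.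
    rewrite !scalerBr !scalerDr addrACA -opprD; congr (_ - _).
    by rewrite addrACA -scalerDl subrKC scale1r.
  have : `|s *: (x.2 - (z0 + x.1)) + (1 - s) *: (y.2 - (z0 + y.1))| <=
     s * `|x.2 - (z0 + x.1)| + (1 - s) * `|y.2 - (z0 + y.1)|.
    case/andP: s01 => s0 s1; apply: le_trans (ler_normD _ _) _.
    by rewrite !normrZ !ger0_norm// subr_ge0.
  by move=> /(ler_wpM2l K0); rewrite /F /=; lra.
- by move=> j x y s _ _ _; rewrite /= colin coZ.
- move=> h; have [x xh] := cosurj h; have [_ [y0 fy0]] := fp.
  by exists (x, y0).
- move=> [h y] /= fy /coinj ->; rewrite /F/= addr0; exact: KP.
exists (fun j => - l j) => y.
have [fy|/negP] := boolP (f y < +oo)%E; last by rewrite ltey => /negP/negPn/eqP->; rewrite leey.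
have := lP (y - z0, y) fy; rewrite /F/= subrKC subrr normr0 mulr0 addr0.
rewrite (eproper_fineE fp fy) lee_fin -lerBlDr -sumrN; congr (_ <= _); congr (_ + _).
apply: eq_bigr => j _; rewrite mulNr; congr (- (_ * _)).
by have := colin (-1) z0 y j; rewrite scaleN1r addrC => ->; lra.
Qed.

End Duality.

(** * Conjugate functions *)

Section Conjugate.
Variables (R : realType) (V : normedModType R) (ip : V -> V -> R).
Hypothesis ip_lin : forall s t p q z,
  ip (s *: p + t *: q) z = s * ip p z + t * ip q z.
Variable f : V -> \bar R.
Hypothesis fp : eproper f.

Lemma fenchel_leP p c : (fenchel ip f p <= c%:E)%E <->
  forall z, edom f z -> ip p z - fine (f z) <= c.
Proof.
split=> [fc z fz|H].
  have := le_trans (ereal_sup_ubound _) fc.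
  move=> /(_ ((ip p z)%:E - f z)%E); rewrite {2}(eproper_fineE fp fz) -EFinB lee_fin.
  by apply; exists z.
apply: ge_ereal_sup => _ [z _ <-].
have [fz|/negP] := boolP (f z < +oo)%E.
  by rewrite (eproper_fineE fp fz) -EFinB lee_fin; exact: H.
by rewrite ltey => /negP/negPn/eqP->; rewrite /= leNye.
Qed.

Lemma fenchel_gtNy p : (-oo < fenchel ip f p)%E.
Proof.
have [_ [z fz]] := fp; apply: (@lt_le_trans _ _ ((ip p z)%:E - f z)%E).
  by rewrite (eproper_fineE fp fz) -EFinB ltNyr.
by apply: ereal_sup_ubound; exists z.
Qed.

Lemma fenchelE p : (fenchel ip f p < +oo)%E ->
  fenchel ip f p = (fine (fenchel ip f p))%:E.
Proof. by move=> fy; rewrite fineK// fin_real// fenchel_gtNy. Qed.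

Lemma fenchel_young p z : (fenchel ip f p < +oo)%E -> edom f z ->
  ip p z <= fine (fenchel ip f p) + fine (f z).
Proof.
move=> fy fz; have /fenchel_leP/(_ _ fz) : (fenchel ip f p <= (fine (fenchel ip f p))%:E)%E.
  by rewrite -fenchelE.
by lra.
Qed.

Lemma fenchel_convex p q (s : R) : (fenchel ip f p < +oo)%E ->
  (fenchel ip f q < +oo)%E -> 0 <= s <= 1 ->
  (fenchel ip f (s *: p + (1 - s) *: q)%R <=
   (s * fine (fenchel ip f p) + (1 - s) * fine (fenchel ip f q))%R%:E)%E.
Proof.
move=> fip fiq /andP[s0 s1]; apply/fenchel_leP => z fz; rewrite ip_lin.
have s1' : 0 <= 1 - s by rewrite subr_ge0.
have := ler_wpM2l s0 (fenchel_young fip fz).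
by have := ler_wpM2l s1' (fenchel_young fiq fz); lra.
Qed.

(** Fenchel-Moreau, in the form in which it is used: an upper bound of the
    affine minorants at z bounds f z. *)
Lemma fenchel_moreau_le (J : finType) (co : V -> J -> R) z (X : R) :
  (forall s x y j, co (s *: x + y) j = s * co x j + co y j) ->
  (forall h : J -> R, exists x, forall j, co x j = h j) ->
  (forall x, (forall j, co x j = 0) -> x = 0) ->
  (forall p x, ip p x = \sum_j co p j * co x j) ->
  proper_convex_lsc f ->
  (forall p c, (fenchel ip f p <= c%:E)%E -> ip p z - c <= X) ->
  (f z <= X%:E)%E.
Proof.
move=> colin cosurj coinj ipE fpcl H; rewrite leNgt; apply/negP => Xf.
have [c Xc cf] : exists2 c, X < c & (c%:E < f z)%E.
  case: (f z) Xf => [v| |//]; last by exists (X + 1); [lra | exact: ltry].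
  by rewrite lte_fin => Xv; exists ((X + v) / 2); rewrite ?lte_fin; lra.
have [l lP] := affine_minorant colin cosurj coinj fpcl cf.
have [p pl] := cosurj l.
have : (fenchel ip f p <= (ip p z - c)%:E)%E.
  apply/fenchel_leP => y fy; have := lP y; rewrite (eproper_fineE fp fy) lee_fin.
  rewrite !ipE => h; suff : \sum_j l j * (co y j - co z j) =
    \sum_j co p j * co y j - \sum_j co p j * co z j by lra.
  by rewrite -sumrB; apply: eq_bigr => j _; rewrite pl mulrBr.
by move/H; lra.
Qed.

End Conjugate.

(** * Suprema and limits *)

Section SumSup.
Variables (R : realType) (I : finType).

(** Bounding a sum of suprema by a common bound of the sums: this is what makes
    a sum of conjugates behave like a single conjugate. *)
Lemma sum_sup_le (S : I -> set R) (c : R) :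
  (forall i, S i !=set0) ->
  (forall y : I -> R, (forall i, S i (y i)) -> \sum_i y i <= c) ->
  (forall i, has_sup (S i)) /\ \sum_i sup (S i) <= c.
Proof.
move=> S0 Sc; have [d dP] := choice S0.
have Ssup i : has_sup (S i).
  split=> //; exists (c - \sum_(j | j != i) d j) => y Sy.
  have := Sc (fun j => if j == i then y else d j).
  rewrite (bigD1 i)//= eqxx (eq_bigr d) => [|j /negbTE->//].
  rewrite lerBrDr; apply=> j; by case: eqP => [->|_].
split=> //; apply/ler_addgt0Pr => e e0.
pose e' := e / (#|I|%:R + 1).
have I0 : 0 < #|I|%:R + 1 :> R by rewrite ltr_wpDl.
have e'0 : 0 < e' by rewrite divr_gt0.
have /choice[y yP] i : exists y, S i y /\ sup (S i) - e' < y.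
  by have [y ? ?] := sup_adherent e'0 (Ssup i); exists y.
have := Sc y (fun i => (yP i).1).
have : \sum_i (sup (S i) - e') <= \sum_i y i.
  by apply: ler_sum => i _; exact: ltW (yP i).2.
rewrite sumrB sumr_const -mulr_natl.
have : e' * (#|I|%:R + 1) = e by rewrite /e' mulfVK// gt_eqF.
rewrite cardE; move: (\sum_i sup (S i)) => ?; lra.
Qed.

End SumSup.

Section Sequences.
Variable R : realType.
Implicit Types u v : nat -> R.

Lemma cvg_le u v a b : u @ \oo --> a -> v @ \oo --> b ->
  (forall k, u k <= v k) -> a <= b.
Proof.
by move=> ua vb uv; apply: (ler_cvg_to ua vb); near=> k; exact: uv.
Unshelve. all: by end_near. Qed.

Lemma cvg_sumr (I : finType) (u : nat -> I -> R) (a : I -> R) :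
  (forall i, u k i @[k --> \oo] --> a i) ->
  \sum_i u k i @[k --> \oo] --> \sum_i a i.
Proof.
by move=> ua; apply: (cvg_big (@add_continuous _)) => i _; exact: ua.
Qed.

Lemma cvg_incr (T : topologicalType) (x : nat -> T) (l : T) (sg : nat -> nat) :
  increasing_seq sg -> x @ \oo --> l -> (x \o sg) @ \oo --> l.
Proof.
move=> sgi xl; apply: cvg_comp xl.
have sgk k : (k <= sg k)%N.
  elim: k => // k /leq_ltn_trans; apply.
  by rewrite ltnNge -leEnat sgi ltnn.
move=> A [N _ NA]; exists N => // k /= Nk; apply: NA => /=.
exact: leq_trans (sgk k).
Qed.

Lemma bounded_family_cvg (J : finType) (x : nat -> J -> R) :
  (forall j, exists M, forall k, `|x k j| <= M) ->
  exists2 sg : nat -> nat, increasing_seq sg &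
  exists l : J -> R, forall j, x (sg k) j @[k --> \oo] --> l j.
Proof.
move=> xb.
suff : exists2 sg : nat -> nat, increasing_seq sg &
    exists l : J -> R, forall j, j \in enum J -> x (sg k) j @[k --> \oo] --> l j.
  move=> [sg sgi [l lP]]; exists sg => //; exists l => j.
  by apply: lP; rewrite mem_enum.
elim: (enum J) => [|i s [sg sgi [l lP]]]; first by exists id => //; exists (fun=> 0).
have [M MP] := xb i.
have [|tau taui /cvg_ex[/= a xa]] := @bolzano_weierstrass R (fun k => x (sg k) i).
  exists M; split; first exact: num_real.
  by move=> e Me k _ /=; rewrite (le_trans (MP _))// ltW.
exists (sg \o tau); first by move=> m k; rewrite /= sgi; exact: taui.
exists (fun j => if j == i then a else l j) => j.
have [->|ji] := eqVneq j i; first by [].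
by rewrite inE (negbTE ji)/= => /lP; exact: (cvg_incr taui).
Qed.

Lemma cvg_sqr0 u : u k ^+ 2 @[k --> \oo] --> 0 -> u @ \oo --> 0.
Proof.
move=> u2; apply/cvgr0Pnorm_lt => e e0.
have /cvgr0Pnorm_lt/(_ (e ^+ 2)) := u2; rewrite exprn_gt0// => /(_ isT).
apply: filterS => k; rewrite normrX ltr_pXn2r// ?nnegrE ?ltW//.
Qed.

(** Phi is nonincreasing and bounded below, so its increments, which dominate N,
    tend to 0. *)
Lemma summable_decrease (Phi N : nat -> R) (K : R) : 0 < K ->
  (forall k, 0 <= Phi k) -> (forall k, 0 <= N k) ->
  (forall k, Phi k.+1 <= Phi k - K * N k) -> N @ \oo --> 0.
Proof.
move=> K0 Phi0 N0 dec.
have Phi_cvg : cvgn Phi.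
  apply: nonincreasing_is_cvgn.
    apply/nonincreasing_seqP => k; apply: le_trans (dec k) _.
    by rewrite lerBlDr lerDl mulr_ge0// ltW.
  by exists 0 => _ [k _ <-].
have dPhi : K^-1 * (Phi k - Phi k.+1) @[k --> \oo] --> 0.
  rewrite -[X in _ --> X](mulr0 K^-1) -(subrr (limn Phi)).
  apply: cvgMl_tmp; apply: cvgB => //.
  by have := cvg_shiftS Phi (nbhs (limn Phi)) => /= ->.
apply: squeeze_cvgr dPhi; last exact: cvg_cst.
near=> k; rewrite N0/= ler_pdivlMl//; have := dec k; lra.
Unshelve. all: by end_near. Qed.

(** The distances to a target do not increase, so the sequence is bounded and
    has a cluster point l, which is a target.  The distance to l tends to 0 along
    a subsequence, hence along the whole sequence since it is monotone. *)
Lemma fejer_cvg (J : finType) (wt : J -> R) (Y : nat -> J -> R)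
    (S : set (J -> R)) :
  (forall j, 0 < wt j) -> S !=set0 ->
  (forall s, S s -> forall k, \sum_j wt j * (Y k.+1 j - s j) ^+ 2 <=
                              \sum_j wt j * (Y k j - s j) ^+ 2) ->
  (forall sg, increasing_seq sg -> forall l : J -> R,
     (forall j, Y (sg k) j @[k --> \oo] --> l j) -> S l) ->
  exists2 l, S l & forall j, Y k j @[k --> \oo] --> l j.
Proof.
move=> wt0 [s0 Ss0] fej clus.
pose Phi s k := \sum_j wt j * (Y k j - s j) ^+ 2.
have term_le s k j : wt j * (Y k j - s j) ^+ 2 <= Phi s k.
  rewrite /Phi (bigD1 j)//= lerDl; apply: sumr_ge0 => i _.
  by rewrite mulr_ge0 ?sqr_ge0// ltW.
have Phi_mono s : S s -> nonincreasing_seq (Phi s).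
  by move=> Ss; apply/nonincreasing_seqP => k; exact: fej.
have [|sg sgi [l lP]] := @bounded_family_cvg J Y.
  move=> j; exists (`|s0 j| + (Phi s0 0%N / wt j + 1)) => k.
  have : (Y k j - s0 j) ^+ 2 <= Phi s0 0%N / wt j.
    rewrite ler_pdivlMr// mulrC (le_trans (term_le _ _ _))//.
    exact: Phi_mono.
  have : `|Y k j| <= `|s0 j| + `|Y k j - s0 j|.
    by rewrite -{1}(subrK (s0 j) (Y k j)) addrC ler_normD.
  have : `|Y k j - s0 j| <= (Y k j - s0 j) ^+ 2 + 1.
    rewrite -real_normK ?num_real//.
    by have := sqr_ge0 (`|Y k j - s0 j| - 1 / 2); nra.
  by lra.
have Sl := clus _ sgi _ lP.
exists l => // j.
have Phisg : Phi l (sg k) @[k --> \oo] --> 0.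
  rewrite (_ : 0 = \sum_j wt j * (l j - l j) ^+ 2); last first.
    by rewrite big1// => i _; rewrite subrr expr0n/= mulr0.
  apply: cvg_sumr => i; apply: cvgMl_tmp; apply: cvgM; apply: cvgB => //; exact: cvg_cst.
have Phi0 : Phi l @ \oo --> 0.
  apply/cvgr0Pnorm_lt => e e0.
  have /cvgr0Pnorm_lt/(_ e e0)[K _ /(_ K (leqnn K))/= PhiK] := Phisg.
  exists (sg K) => // k /= sgk; apply: le_lt_trans PhiK.
  have Pge k' : 0 <= Phi l k'.
    by apply: sumr_ge0 => i _; rewrite mulr_ge0 ?sqr_ge0// ltW.
  by rewrite !ger0_norm//; exact: Phi_mono.
have : Y k j - l j @[k --> \oo] --> 0.
  apply: cvg_sqr0.
  have W : (wt j)^-1 * Phi l k @[k --> \oo] --> 0.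
    by rewrite -[X in _ --> X](mulr0 (wt j)^-1); exact: cvgMl_tmp.
  apply: squeeze_cvgr W; last exact: cvg_cst.
  near=> k; rewrite sqr_ge0/= ler_pdivlMl//; exact: term_le.
move=> Yl; rewrite -[X in _ --> X](add0r (l j)).
rewrite (_ : (fun k => Y k j) = (fun k => (Y k j - l j) + l j)).
  by apply: cvgD => //; exact: cvg_cst.
by apply/funext => k; rewrite subrK.
Unshelve. all: by end_near. Qed.

End Sequences.

(** * Inner products and the constraint operators *)

Section Dot.
Variables (R : realType) (A : finType).
Implicit Types f g h : fspace R A.

Lemma dotC f g : dot f g = dot g f.
Proof. by apply: eq_bigr => i _; rewrite mulrC. Qed.

Lemma dot_linl (s t : R) f g h :
  dot (s *: f + t *: g) h = s * dot f h + t * dot g h.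
Proof.
rewrite /dot !mulr_sumr -big_split/=; apply: eq_bigr => i _.
by rewrite !ffunE /GRing.scale/=; ring.
Qed.

Lemma dotZl s f h : dot (s *: f) h = s * dot f h.
Proof. by have := dot_linl s 0 f f h; rewrite scale0r addr0 mul0r addr0. Qed.

Lemma dot0l h : dot 0 h = 0.
Proof. by rewrite /dot big1// => i _; rewrite ffunE mul0r. Qed.

Lemma dotDl f g h : dot (f + g) h = dot f h + dot g h.
Proof. by have := dot_linl 1 1 f g h; rewrite !scale1r !mul1r. Qed.

Lemma dotNl f h : dot (- f) h = - dot f h.
Proof. by rewrite -scaleN1r dotZl mulN1r. Qed.

Lemma dotDr f g h : dot h (f + g) = dot h f + dot h g.
Proof. by rewrite dotC dotDl !(dotC h). Qed.

Lemma dotZr s f h : dot h (s *: f) = s * dot h f.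
Proof. by rewrite dotC dotZl (dotC h). Qed.

Lemma dotNr f h : dot h (- f) = - dot h f.
Proof. by rewrite dotC dotNl (dotC h). Qed.

Definition dotE := (dotDl, dotDr, dotNl, dotNr, dotZl, dotZr).

Lemma cvg_dot (f g : nat -> fspace R A) f' g' :
  (forall i, f k i @[k --> \oo] --> f' i) ->
  (forall i, g k i @[k --> \oo] --> g' i) ->
  dot (f k) (g k) @[k --> \oo] --> dot f' g'.
Proof. by move=> cf cg; apply: cvg_sumr => i; apply: cvgM. Qed.

Lemma cvg_fspace (f : nat -> fspace R A) f' :
  (forall i, f k i @[k --> \oo] --> f' i) -> f @ \oo --> f'.
Proof.
move=> cf; have d0 : dot (f k - f') (f k - f') @[k --> \oo] --> 0.
  rewrite (_ : 0 = dot (f' - f') (f' - f')); last first.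
    by rewrite subrr dot0l.
  by apply: cvg_dot => i; rewrite !ffunE; under eq_fun do rewrite !ffunE;
    apply: cvgB => //; exact: cvg_cst.
apply/cvgrPdist_lt => e e0.
have /cvgr0Pnorm_lt/(_ (e ^+ 2)) := d0; rewrite exprn_gt0// => /(_ isT).
apply: filterS => k; rewrite ger0_norm ?dot_ge0// => h.
rewrite -normrN opprB normE -(ltr_pXn2r (ltn0Sn 1)) ?nnegrE ?sqrtr_ge0 ?ltW//.
by rewrite sqr_sqrtr// dot_ge0.
Qed.

End Dot.

Section Fspace.
Variables (R : realType) (A : finType).

Lemma biconjugate_le (f : fspace R A -> \bar R) z (X : R) :
  proper_convex_lsc f ->
  (forall p c, (fenchel (@dot R A) f p <= c%:E)%E -> dot p z - c <= X) ->
  (f z <= X%:E)%E.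
Proof.
move=> fpcl; have [fp _ _] := fpcl.
apply: (@fenchel_moreau_le _ _ _ f fp A (fun p j => p j)) => //.
- by move=> s x y j; rewrite !ffunE.
- by move=> h; exists [ffun j => h j] => j; rewrite ffunE.
- by move=> x x0; apply/ffunP => j; rewrite x0 ffunE.
Qed.

Lemma biconjugate_le_line (f : R^o -> \bar R) z (X : R) :
  proper_convex_lsc f ->
  (forall p c, (fenchel (fun p z : R^o => (p * z)%R) f p <= c%:E)%E ->
     p * z - c <= X) ->
  (f z <= X%:E)%E.
Proof.
move=> fpcl; have [fp _ _] := fpcl.
apply: (@fenchel_moreau_le _ _ _ f fp unit (fun p _ => p)) => //.
- by move=> h; exists (h tt) => -[].
- by move=> x; apply; exact: tt.
- by move=> p x; rewrite big_const card_unit/= addr0.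
Qed.

End Fspace.

Section Operators.
Variables (R : realType) (T n : nat) (d : mfc_data R T n).
Local Notation spaceR := (spaceR R T n).
Local Notation spaceU := (spaceU R T n).
Implicit Types (u m : spaceTbS R T n) (w : spaceTSS R T n) (P : spaceT R T).
Implicit Types (gP : spaceU) (ab p q : spaceR).

Lemma dotRC p q : dotR p q = dotR q p.
Proof. by rewrite /dotR !(dotC p.1) !(dotC p.2). Qed.
Lemma dotRDl p q l : dotR (p + q) l = dotR p l + dotR q l.
Proof. by rewrite /dotR !dotE addrACA. Qed.
Lemma dotRZl s p l : dotR (s *: p) l = s * dotR p l.
Proof. by rewrite /dotR !dotE mulrDr. Qed.
Lemma dotRNl p l : dotR (- p) l = - dotR p l.
Proof. by rewrite /dotR !dotE opprD. Qed.
Lemma dotRDr p q l : dotR l (p + q) = dotR l p + dotR l q.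
Proof. by rewrite dotRC dotRDl !(dotRC l). Qed.
Lemma dotRZr s p l : dotR l (s *: p) = s * dotR l p.
Proof. by rewrite dotRC dotRZl (dotRC l). Qed.
Lemma dotRNr p l : dotR l (- p) = - dotR l p.
Proof. by rewrite dotRC dotRNl (dotRC l). Qed.

Definition dotRE := (dotRDl, dotRDr, dotRNl, dotRNr, dotRZl, dotRZr).

Lemma dotR_ge0 p : 0 <= dotR p p.
Proof. by rewrite addr_ge0 ?dot_ge0. Qed.

Lemma enormR_sqr p : enormR p ^+ 2 = dotR p p.
Proof. by rewrite sqr_sqrtr ?dotR_ge0. Qed.

Lemma sum_TSS (F : 'I_T * 'I_n * 'I_n -> R) :
  \sum_i F i = \sum_t \sum_x \sum_y F (t, x, y).
Proof.
rewrite (pair_bigA _ (fun t x => \sum_y F (t, x, y)))/=.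
rewrite (pair_bigA _ (fun tx y => F (tx.1, tx.2, y)))/=.
by apply: eq_bigr => -[[t x] y].
Qed.

Lemma sum_TbS (F : 'I_T.+1 * 'I_n -> R) : \sum_i F i = \sum_s \sum_x F (s, x).
Proof.
by rewrite (pair_bigA _ (fun s x => F (s, x)))/=; apply: eq_bigr => -[].
Qed.

Lemma dot_opA w P : dot (opA d w) P = dot w (opA_adj d P).
Proof.
rewrite /dot sum_TSS; apply: eq_bigr => t _; rewrite ffunE mulr_suml.
apply: eq_bigr => x _; rewrite mulr_suml; apply: eq_bigr => y _.
by rewrite ffunE mulrA.
Qed.

Lemma dot_opS w u : dot (opS w) u = dot w (opS_adj u).
Proof.
rewrite /dot sum_TSS sum_TbS big_ord_recl big1 ?add0r => [|x _]; last first.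
  by rewrite ffunE/= unlift_none mul0r.
apply: eq_bigr => t _; rewrite [RHS]exchange_big; apply: eq_bigr => x _.
rewrite ffunE/= liftK mulr_suml; apply: eq_bigr => y _.
by rewrite !ffunE.
Qed.

Lemma dot_bar_m0 u : dot (bar_m0 d) u = \sum_x m0 d x * u (ord0, x).
Proof.
rewrite /dot sum_TbS big_ord_recl [X in _ + X]big1 ?addr0 => [|t _].
  by apply: eq_bigr => x _; rewrite ffunE.
by rewrite big1// => x _; rewrite ffunE/= mul0r.
Qed.

Lemma dot_time_cur m (a : spaceTbS R T n) : (forall x, a (ord_max, x) = 0) ->
  dot m a = \sum_t \sum_x m (time_cur t, x) * a (time_cur t, x).
Proof.
move=> aT; rewrite /dot sum_TbS big_ord_recr/= [X in _ + X]big1 ?addr0// => x _.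
by rewrite aT mulr0.
Qed.

Lemma dot_at_state w (b : spaceTSS R T n) :
  dot w b = \sum_t \sum_x dot (at_state w t x) (at_state b t x).
Proof.
rewrite {1}/dot sum_TSS; apply: eq_bigr => t _; apply: eq_bigr => x _.
by apply: eq_bigr => y _; rewrite !ffunE.
Qed.

Lemma dot_at_time m u :
  dot m u = \sum_s dot (at_time m s) (at_time u s).
Proof.
rewrite {1}/dot sum_TbS; apply: eq_bigr => s _.
by apply: eq_bigr => x _; rewrite !ffunE.
Qed.

Definition A1 u : spaceR := (u, - opS_adj u).

Lemma residualE u gP ab : residual d u gP ab = A1 u + A2 d gP + A3 ab.
Proof.
by rewrite /residual /A1 /A2 /A3; congr pair => /=; rewrite [X in X - _]addrC.
Qed.

Lemma A1D u v : A1 (u + v) = A1 u + A1 v.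
Proof. by rewrite /A1; congr pair; apply/ffunP => i; rewrite !ffunE opprD. Qed.

Lemma A1Z s u : A1 (s *: u) = s *: A1 u.
Proof. by rewrite /A1; congr pair; apply/ffunP => i; rewrite !ffunE scalerN. Qed.

Lemma A1N u : A1 (- u) = - A1 u.
Proof. by rewrite -scaleN1r A1Z scaleN1r. Qed.

Lemma A2D gP (gP' : spaceU) : A2 d (gP + gP') = A2 d gP + A2 d gP'.
Proof.
by rewrite /A2; congr pair; apply/ffunP => i; rewrite !ffunE ?mulrDr opprD.
Qed.

Lemma A2Z s gP : A2 d (s *: gP) = s *: A2 d gP.
Proof.
by rewrite /A2; congr pair; apply/ffunP => i; rewrite !ffunE/= /GRing.scale/=; ring.
Qed.

Lemma A2B gP (gP' : spaceU) : A2 d (gP - gP') = A2 d gP - A2 d gP'.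
Proof. by rewrite A2D -scaleN1r A2Z scaleN1r. Qed.

Lemma A3E ab : A3 ab = - ab.
Proof. by case: ab. Qed.

(** The algebra of weak duality, with the state equation, the copy of m and the
    equation of D perturbed by e1, e2 and e3. *)
Lemma residual0_pairing u gP ab m w (e1 e2 : spaceTbS R T n) (e3 : spaceT R T) :
  residual d u gP ab = 0 -> m = opS w + bar_m0 d + e1 ->
  dot m ab.1 + dot w ab.2 + dot (opA d w + e3) gP.2 + dot (m + e2) gP.1
  = dot (bar_m0 d) u + dot e1 u + dot e2 gP.1 + dot e3 gP.2.
Proof.
case: gP ab => [g P] [a b] [/eqP ra /eqP rb] -> /=.
move: ra rb; rewrite !subr_eq0 => /eqP <- /eqP <-.
by rewrite !dotE !dot_opA !dot_opS; ring.
Qed.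

End Operators.

(** * The dual cost and the set Q *)

Section DualCost.
Variables (R : realType) (T n : nat) (d : mfc_data R T n).
Hypothesis hd : standing_assumption d.
Local Notation spaceR := (spaceR R T n).
Local Notation spaceU := (spaceU R T n).
Implicit Types (u m : spaceTbS R T n) (w : spaceTSS R T n) (P : spaceT R T).
Implicit Types (gP : spaceU) (ab : spaceR).

Lemma ell_pcl t x : proper_convex_lsc (ell d t x).
Proof. by have [_ H _ _] := hd; have [] := H t x. Qed.

Lemma ell_simplex t x : edom (ell d t x) `<=` @simplex R 'I_n.
Proof. by have [_ H _ _] := hd; have [] := H t x. Qed.

Lemma phi_pcl t : proper_convex_lsc (phi d t).
Proof. by have [_ _ H _] := hd. Qed.

Lemma costF_pcl s : proper_convex_lsc (costF d s).
Proof. by have [_ _ _ H] := hd. Qed.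

Lemma ell_proper t x : eproper (ell d t x).
Proof. by have [] := ell_pcl t x. Qed.

Lemma phi_proper t : eproper (phi d t).
Proof. by have [] := phi_pcl t. Qed.

Lemma costF_proper s : eproper (costF d s).
Proof. by have [] := costF_pcl s. Qed.

Lemma mulR_lin (s t : R) (p q z : R^o) :
  (s *: p + t *: q) * z = s * (p * z) + t * (q * z).
Proof. by rewrite /GRing.scale/=; ring. Qed.

(** [conj_dom] and [conj_cost] encode the extended-real term in (gamma, P) of
    the dual cost by its domain and its real values there. *)
Definition conj_dom : set spaceU := [set gP : spaceU |
  (forall t, (phi_conj d t (gP.2 t) < +oo)%E) /\
  (forall s, (costF_conj d s (at_time gP.1 s) < +oo)%E)].

Definition conj_cost gP : R := \sum_t fine (phi_conj d t (gP.2 t)) +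
                        \sum_s fine (costF_conj d s (at_time gP.1 s)).

Lemma at_time_lin (a b : R) u m s :
  at_time (a *: u + b *: m) s = a *: at_time u s + b *: at_time m s.
Proof. by apply/ffunP => x; rewrite !ffunE. Qed.

Lemma at_state_lin (a b : R) w (w' : spaceTSS R T n) t x :
  at_state (a *: w + b *: w') t x = a *: at_state w t x + b *: at_state w' t x.
Proof. by apply/ffunP => y; rewrite !ffunE. Qed.

Lemma conj_cost_convex : convex_set_on conj_dom /\ convex_fun_on conj_dom conj_cost.
Proof.
have phiC t (p q s : R) : (phi_conj d t p < +oo)%E -> (phi_conj d t q < +oo)%E ->
    0 <= s <= 1 -> (phi_conj d t (s * p + (1 - s) * q)%R
     <= (s * fine (phi_conj d t p) + (1 - s) * fine (phi_conj d t q))%R%:E)%E.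
  by move=> *; exact: (fenchel_convex mulR_lin (phi_proper t)).
have FC s0 p q (s : R) : (costF_conj d s0 p < +oo)%E ->
    (costF_conj d s0 q < +oo)%E -> 0 <= s <= 1 ->
    (costF_conj d s0 (s *: p + (1 - s) *: q)%R
     <= (s * fine (costF_conj d s0 p) + (1 - s) * fine (costF_conj d s0 q))%R%:E)%E.
  by move=> *; exact: (fenchel_convex (@dot_linl R _) (costF_proper s0)).
have D2c : convex_set_on conj_dom.
  move=> gP gP' s [dphi dF] [dphi' dF'] s01; split=> [t|s0].
    rewrite /= !ffunE; apply: le_lt_trans (phiC t _ _ _ (dphi t) (dphi' t) s01) _.
    exact: ltry.
  rewrite /= at_time_lin; apply: le_lt_trans (FC s0 _ _ _ (dF s0) (dF' s0) s01) _.
  exact: ltry.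
split=> // gP gP' s D D' s01; have [dphi'' dF''] := D2c _ _ _ D D' s01.
have [dphi dF] := D; have [dphi' dF'] := D'.
rewrite /conj_cost !mulrDr addrACA !mulr_sumr -!big_split/=; apply: lerD.
  apply: ler_sum => t _; rewrite -lee_fin.
  rewrite [X in (X <= _)%E](_ : _ = phi_conj d t (s * gP.2 t + (1 - s) * gP'.2 t)).
    exact: phiC.
  have -> : s * gP.2 t + (1 - s) * gP'.2 t = (s *: gP + (1 - s) *: gP').2 t.
    by rewrite /= !ffunE.
  exact/esym/(fenchelE (phi_proper t))/dphi''.
apply: ler_sum => s0 _; rewrite -lee_fin.
rewrite [X in (X <= _)%E](_ : _ = costF_conj d s0 (at_time (s *: gP.1 + (1 - s) *: gP'.1) s0)).
  by rewrite at_time_lin; exact: FC.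
exact/esym/(fenchelE (costF_proper s0))/dF''.
Qed.

(** If a conjugate were +oo everywhere, the function would be -oo by
    biconjugation. *)
Lemma conj_dom_nonempty : conj_dom !=set0.
Proof.
have /choice[P PP] t : exists p, (phi_conj d t p < +oo)%E.
  apply: contrapT => H; have [_ [z fz]] := phi_proper t.
  have : (phi d t z <= (fine (phi d t z) - 1)%R%:E)%E.
    apply: biconjugate_le_line (phi_pcl t) _ => p c pc; exfalso; apply: H; exists p.
    exact: le_lt_trans pc (ltry _).
  by rewrite {1}(eproper_fineE (phi_proper t) fz) lee_fin; lra.
have /choice[g gP] s : exists p, (costF_conj d s p < +oo)%E.
  apply: contrapT => H; have [_ [z fz]] := costF_proper s.
  have : (costF d s z <= (fine (costF d s z) - 1)%R%:E)%E.
    apply: biconjugate_le (costF_pcl s) _ => p c pc; exfalso; apply: H; exists p.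
    exact: le_lt_trans pc (ltry _).
  by rewrite {1}(eproper_fineE (costF_proper s) fz) lee_fin; lra.
exists ([ffun i => g i.1 i.2], [ffun t => P t]); split=> [t|s].
  by rewrite ffunE.
by rewrite (_ : at_time _ s = g s)//; apply/ffunP => x; rewrite !ffunE.
Qed.

(** Sequential lower semicontinuity.  The terms of the sum could diverge
    separately, so the inequality is passed to the limit for a fixed choice of
    one affine minorant per term, and only then are the suprema taken. *)
Lemma conj_cost_lsc (gP : nat -> spaceU) gP' (c : nat -> R) c' :
  (forall k, conj_dom (gP k)) -> (forall k, conj_cost (gP k) <= c k) ->
  (forall i, (gP k).1 i @[k --> \oo] --> gP'.1 i) ->
  (forall t, (gP k).2 t @[k --> \oo] --> gP'.2 t) ->
  c @ \oo --> c' -> conj_dom gP' /\ conj_cost gP' <= c'.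
Proof.
move=> gPd gPc cg cP cc.
pose S (i : 'I_T + 'I_T.+1) : set R := match i with
  | inl t => [set gP'.2 t * z - fine (phi d t z) | z in edom (phi d t)]
  | inr s => [set dot (at_time gP'.1 s) z - fine (costF d s z)
             | z in edom (costF d s)] end.
have S0 i : S i !=set0.
  case: i => [t|s]; first by have [_ [z fz]] := phi_proper t; eexists; exists z.
  by have [_ [z fz]] := costF_proper s; eexists; exists z.
have [y Sy|Ssup Sle] := @sum_sup_le R _ S c' S0.
  pose h k (i : 'I_T + 'I_T.+1) := match i with
    | inl t => fine (phi_conj d t ((gP k).2 t))
    | inr s => fine (costF_conj d s (at_time (gP k).1 s)) end.
  have /choice[v vP] i : exists v : nat -> R,
      v @ \oo --> y i /\ forall k, v k <= h k i.
    case: i (Sy i) => [t|s] [z fz <-].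
      exists (fun k => (gP k).2 t * z - fine (phi d t z)); split.
        by apply: cvgB; [apply: cvgMr_tmp | exact: cvg_cst].
      move=> k; have := fenchel_young (phi_proper t) ((gPd k).1 t) fz.
      by rewrite /h /phi_conj; lra.
    exists (fun k => dot (at_time (gP k).1 s) z - fine (costF d s z)); split.
      apply: cvgB; last exact: cvg_cst.
      apply: cvg_dot => x; last exact: cvg_cst.
      by rewrite ffunE; under eq_fun do rewrite ffunE; exact: cg.
    move=> k; have := fenchel_young (costF_proper s) ((gPd k).2 s) fz.
    by rewrite /h /costF_conj; lra.
  apply: (@cvg_le _ (fun k => \sum_i v i k) c) => //.
    by apply: cvg_sumr => i; exact: (vP i).1.
  move=> k; apply: le_trans (gPc k); apply: le_trans (ler_sum _ _) _.
    by move=> i _; exact: (vP i).2.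
  by rewrite big_sumType.
have phile t : (phi_conj d t (gP'.2 t) <= (sup (S (inl t)))%:E)%E.
  apply/(fenchel_leP _ (phi_proper t)) => z fz; apply: ub_le_sup; last by exists z.
  by have [] := Ssup (inl t).
have Fle s : (costF_conj d s (at_time gP'.1 s) <= (sup (S (inr s)))%:E)%E.
  apply/(fenchel_leP _ (costF_proper s)) => z fz; apply: ub_le_sup; last by exists z.
  by have [] := Ssup (inr s).
have D : conj_dom gP'.
  by split=> [t|s]; [exact: le_lt_trans (phile t) (ltry _) | exact: le_lt_trans (Fle s) (ltry _)].
split=> //; apply: le_trans Sle; rewrite big_sumType /conj_cost /=; apply: lerD.
  apply: ler_sum => t _; rewrite -lee_fin; apply: le_trans (phile t).
  by rewrite /phi_conj -(fenchelE (phi_proper t) (D.1 t)).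
apply: ler_sum => s _; rewrite -lee_fin; apply: le_trans (Fle s).
by rewrite /costF_conj -(fenchelE (costF_proper s) (D.2 s)).
Qed.

(** The domain of ell(t, x, .) is bounded and ell(t, x, .) has linear growth from
    below. *)
Lemma ell_conj_finite t x b : (ell_conj d t x b < +oo)%E.
Proof.
have [y0 [K [B KB]]] := convex_lsc_lower_bound (ell_pcl t x).
suff : (ell_conj d t x b <= (`|b| - B + `|K| * (1 + `|y0|))%R%:E)%E.
  by move=> /le_lt_trans; apply; exact: ltry.
apply/(fenchel_leP _ (ell_proper t x)) => z fz.
have z1 : `|z| <= 1.
  have [z01 zs] := ell_simplex fz.
  rewrite normE -[leRHS]sqrtr1 ler_sqrt// -zs; apply: ler_sum => y _.
  by have /andP[z0 z1] := z01 y; rewrite ler_piMl.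
have bz : dot b z <= `|b|.
  exact: le_trans (dot_le_enorm b z) (ler_piMr (normr_ge0 b) z1).
have : K * `|z - y0| <= `|K| * (1 + `|y0|).
  apply: (@le_trans _ _ (`|K| * `|z - y0|)); first by rewrite ler_wpM2r// ler_norm.
  by rewrite ler_wpM2l// (le_trans (ler_normB _ _))// lerD2r.
by have := KB _ fz; lra.
Qed.

Lemma setQP ab : setQ d ab <->
  (forall t x, (ell_conj d t x (at_state ab.2 t x) <=
                 (- ab.1 (time_cur t, x))%R%:E)%E) /\
  (forall x, ab.1 (ord_max, x) = 0).
Proof.
have E t x : (ell_conj d t x (at_state ab.2 t x) + (ab.1 (time_cur t, x))%:E <= 0)%E =
    (ell_conj d t x (at_state ab.2 t x) <= (- ab.1 (time_cur t, x))%R%:E)%E.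
  rewrite /ell_conj (fenchelE (ell_proper t x) (ell_conj_finite t x _)) -EFinD !lee_fin.
  by rewrite -subr_ge0 sub0r opprD addrC -[RHS]subr_ge0.
by split=> -[Q1 Q2]; split=> // t x; have := Q1 t x; rewrite E.
Qed.

Lemma setQ_young ab t x z : setQ d ab -> edom (ell d t x) z ->
  dot (at_state ab.2 t x) z + ab.1 (time_cur t, x) <= fine (ell d t x z).
Proof.
move=> /setQP[Q1 _] fz.
by have /(fenchel_leP _ (ell_proper t x))/(_ _ fz) := Q1 t x; lra.
Qed.

Lemma setQ_convex : convex_set_on (setQ d).
Proof.
move=> ab ab' s Q Q' /andP[s0 s1]; apply/setQP; split=> [t x|x]; last first.
  have /setQP[_ a0] := Q; have /setQP[_ a0'] := Q'.
  by rewrite /= !ffunE a0 a0' !scaler0 addr0.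
apply/(fenchel_leP _ (ell_proper t x)) => z fz.
have s1' : 0 <= 1 - s by rewrite subr_ge0.
have := ler_wpM2l s0 (setQ_young Q fz).
have := ler_wpM2l s1' (setQ_young Q' fz).
by rewrite /= at_state_lin dot_linl !ffunE /GRing.scale/=; lra.
Qed.

Lemma setQ_closed (ab : nat -> spaceR) ab' :
  (forall k, setQ d (ab k)) ->
  (forall i, (ab k).1 i @[k --> \oo] --> ab'.1 i) ->
  (forall i, (ab k).2 i @[k --> \oo] --> ab'.2 i) -> setQ d ab'.
Proof.
move=> Q ca cb; apply/setQP; split=> [t x|x]; last first.
  have := ca (ord_max, x); rewrite (_ : (fun k => _) = fun=> 0); last first.
    by apply/funext => k; have /setQP[_] := Q k.
  by move=> /(cvg_unique _) /(_ (cvg_cst _)) ->.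
apply/(fenchel_leP _ (ell_proper t x)) => z fz.
rewrite lerNr.
apply: (@cvg_le _ (fun k => (ab k).1 (time_cur t, x))
  (fun k => - (dot (at_state (ab k).2 t x) z - fine (ell d t x z)))) => //.
  apply: cvgN; apply: cvgB; last exact: cvg_cst.
  apply: cvg_dot => y; last exact: cvg_cst.
  by rewrite ffunE; under eq_fun do rewrite ffunE; exact: cb.
by move=> k; have := setQ_young (Q k) fz; lra.
Qed.

End DualCost.

(** * Optimality conditions and saddle points *)

Section CoordinateConvergence.
Variables (R : realType) (A B : finType).
Local Notation E := (fspace R A * fspace R B)%type.

Definition coord_cvg (x : nat -> E) (x' : E) :=
  (forall i, (x k).1 i @[k --> \oo] --> x'.1 i) /\
  (forall i, (x k).2 i @[k --> \oo] --> x'.2 i).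

Lemma coord_cvg_cst x : coord_cvg (fun=> x) x.
Proof. by split=> i; exact: cvg_cst. Qed.

Lemma coord_cvgD x y x' y' : coord_cvg x x' -> coord_cvg y y' ->
  coord_cvg (fun k => x k + y k) (x' + y').
Proof.
move=> [cx1 cx2] [cy1 cy2]; split=> i; rewrite /= ffunE;
  under eq_fun do rewrite /= ffunE; by apply: cvgD.
Qed.

Lemma coord_cvgZ s x x' : coord_cvg x x' ->
  coord_cvg (fun k => s *: x k) (s *: x').
Proof.
move=> [cx1 cx2]; split=> i; rewrite /= ffunE;
  under eq_fun do rewrite /= ffunE; by apply: cvgMl_tmp.
Qed.

Lemma coord_cvgN x x' : coord_cvg x x' -> coord_cvg (fun k => - x k) (- x').
Proof.
move=> [cx1 cx2]; split=> i; rewrite /= ffunE;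
  under eq_fun do rewrite /= ffunE; by apply: cvgN.
Qed.

Lemma coord_cvgB x y x' y' : coord_cvg x x' -> coord_cvg y y' ->
  coord_cvg (fun k => x k - y k) (x' - y').
Proof. by move=> cx cy; apply: coord_cvgD => //; exact: coord_cvgN. Qed.

End CoordinateConvergence.

Section SaddlePoints.
Variables (R : realType) (T n : nat) (d : mfc_data R T n).
Hypothesis hd : standing_assumption d.
Local Notation spaceR := (spaceR R T n).
Local Notation spaceU := (spaceU R T n).
Implicit Types (u m : spaceTbS R T n) (w : spaceTSS R T n) (P : spaceT R T).
Implicit Types (gP : spaceU) (ab l : spaceR).

Lemma coord_cvg_A1 (u : nat -> spaceTbS R T n) u' :
  (forall i, u k i @[k --> \oo] --> u' i) ->
  coord_cvg (fun k => A1 (u k)) (A1 u').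
Proof.
move=> cu; split=> i /=; first exact: cu.
rewrite !ffunE; under eq_fun do rewrite !ffunE.
by apply: cvgN; exact: cu.
Qed.

Lemma coord_cvg_A2 (gP : nat -> spaceU) gP' : coord_cvg gP gP' ->
  coord_cvg (fun k => A2 d (gP k)) (A2 d gP').
Proof.
move=> [cg cP]; split=> i /=; rewrite !ffunE;
  under eq_fun do rewrite !ffunE; apply: cvgN; first exact: cg.
by apply: cvgMl_tmp; exact: cP.
Qed.

Lemma coord_cvg_A3 (ab : nat -> spaceR) ab' : coord_cvg ab ab' ->
  coord_cvg (fun k => A3 (ab k)) (A3 ab').
Proof.
rewrite A3E (_ : (fun k => _) = fun k => - ab k); first exact: coord_cvgN.
by apply/funext => k; rewrite A3E.
Qed.

Lemma cvg_dotR (p q : nat -> spaceR) p' q' : coord_cvg p p' -> coord_cvg q q' ->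
  dotR (p k) (q k) @[k --> \oo] --> dotR p' q'.
Proof. by move=> [? ?] [? ?]; apply: cvgD; exact: cvg_dot. Qed.

(** Stationarity of the Lagrangian in the blocks u, (gamma, P) and (a, b), with
    one multiplier per block: at a saddle point the three agree, along the
    algorithm they differ. *)
Definition optimality (l1 l2 l3 : spaceR) gP ab := [/\
  forall h, dotR l1 (A1 h) = dot (bar_m0 d) h,
  conj_dom d gP /\ (forall gP', conj_dom d gP' ->
    conj_cost d gP + dotR l2 (A2 d gP) <= conj_cost d gP' + dotR l2 (A2 d gP')) &
  setQ d ab /\ (forall ab', setQ d ab' ->
    dotR l3 (A3 ab) <= dotR l3 (A3 ab'))].

(** The subdifferentials of the three blocks are monotone; the first block is
    affine, which yields an equality. *)
Lemma optimality_monotone l1 l2 l3 gP ab (k1 k2 k3 : spaceR) gP' ab' h :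
  optimality l1 l2 l3 gP ab -> optimality k1 k2 k3 gP' ab' ->
  [/\ dotR (l1 - k1) (A1 h) = 0,
      dotR (l2 - k2) (A2 d gP - A2 d gP') <= 0 &
      dotR (l3 - k3) (A3 ab - A3 ab') <= 0].
Proof.
move=> [C1 [D C2] [Q C3]] [N1 [D' N2] [Q' N3]]; split.
- by rewrite !dotRE C1 N1 subrr.
- by have := C2 _ D'; have := N2 _ D; rewrite !dotRE; lra.
- by have := C3 _ Q'; have := N3 _ Q; rewrite !dotRE; lra.
Qed.

Lemma optimality_lim (l1 l2 l3 : nat -> spaceR) (gP : nat -> spaceU)
    (ab : nat -> spaceR) l1' l2' l3' gP' ab' :
  (forall k, optimality (l1 k) (l2 k) (l3 k) (gP k) (ab k)) ->
  coord_cvg l1 l1' -> coord_cvg l2 l2' -> coord_cvg l3 l3' ->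
  coord_cvg gP gP' -> coord_cvg ab ab' ->
  optimality l1' l2' l3' gP' ab'.
Proof.
move=> opt c1 c2 c3 cg cab.
have D k : conj_dom d (gP k) by have [_ []] := opt k.
have Q k : setQ d (ab k) by have [_ _ []] := opt k.
have f2lim gP'' : conj_dom d gP'' -> conj_dom d gP' /\
    conj_cost d gP' <= conj_cost d gP'' + dotR l2' (A2 d gP'' - A2 d gP').
  move=> D''; apply: (@conj_cost_lsc _ _ _ _ hd gP _ (fun k =>
    conj_cost d gP'' + dotR (l2 k) (A2 d gP'' - A2 d (gP k)))) => //.
  - move=> k; have [_ [_ /(_ _ D'')]] := opt k.
    by rewrite !dotRE; lra.
  - exact: cg.1.
  - exact: cg.2.
  apply: cvgD; first exact: cvg_cst.
  apply: cvg_dotR => //; apply: coord_cvgB; first exact: coord_cvg_cst.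
  exact: coord_cvg_A2.
split.
- move=> h; have := cvg_dotR c1 (coord_cvg_cst (A1 h)).
  rewrite (_ : (fun k => _) = fun=> dot (bar_m0 d) h).
    by move=> c; exact: (cvg_unique _ c (cvg_cst _)).
  by apply/funext => k; have [-> _ _] := opt k.
- have [gP0 D0] := conj_dom_nonempty hd; have [D' _] := f2lim _ D0.
  split=> // gP'' D''; have [_] := f2lim _ D''.
  by rewrite !dotRE; lra.
- split; first by apply: setQ_closed Q cab.1 cab.2.
  move=> ab'' Q''; apply: (@cvg_le _ (fun k => dotR (l3 k) (A3 (ab k)))
     (fun k => dotR (l3 k) (A3 ab''))).
  + by apply: cvg_dotR => //; exact: coord_cvg_A3.
  + by apply: cvg_dotR => //; exact: coord_cvg_cst.
  + by move=> k; have [_ _ [_ ->]] := opt k.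
Qed.

(** The multiplier l = (m, w) is the primal unknown. *)
Definition saddle u gP ab l :=
  residual d u gP ab = 0 /\ optimality l l l gP ab.

(** The only (a, b) for which the residual of (u, gP, (a, b)) vanishes. *)
Definition dual_slack u gP : spaceR :=
  (u - gP.1, - opA_adj d gP.2 - opS_adj u).

Lemma residual_dual_slack u gP ab : residual d u gP ab = 0 <-> ab = dual_slack u gP.
Proof.
rewrite /residual /dual_slack; case: ab => a b /=; split.
  by move=> [/eqP + /eqP]; rewrite !subr_eq0 => /eqP -> /eqP ->.
by move=> [-> ->]; rewrite !subrr.
Qed.

Lemma dual_feasibleE u gP : dual_feasible d (u, gP) <-> setQ d (dual_slack u gP).
Proof.
case: gP => [g P]; rewrite setQP//=.
have bE t x : at_state (- opA_adj d P - opS_adj u) t x =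
    - (P t *: at_state (alpha d) t x) - at_time u (time_succ t).
  by apply/ffunP => y; rewrite !ffunE /= [P t *: _]mulrC.
have E t x : ((u (time_cur t, x))%:E + ell_conj d t x
    (- (P t *: at_state (alpha d) t x) - at_time u (time_succ t))%R <=
     (g (time_cur t, x))%:E)%E =
   (ell_conj d t x (at_state (- opA_adj d P - opS_adj u)%R t x) <=
     (- (u - g) (time_cur t, x))%R%:E)%E.
  rewrite bE; set b := _ - _.
  rewrite /ell_conj (fenchelE (ell_proper hd t x) (ell_conj_finite hd t x b)) -EFinD !lee_fin.
  by rewrite !ffunE opprB lerBrDl.
split=> -[H1 H2]; split.
- by move=> t x; rewrite -E.
- move=> x; have := congr1 (fun f : spaceS R n => f x) H2.
  by rewrite !ffunE => ->; rewrite subrr.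
- by move=> t x; rewrite E.
- apply/ffunP => x; have /eqP := H2 x.
  by rewrite !ffunE subr_eq0 => /eqP.
Qed.

Lemma dual_valueE u gP : conj_dom d gP ->
  dual_value d (u, gP) = (dot (bar_m0 d) u - conj_cost d gP)%:E.
Proof.
case: gP => g P [Dphi DF]; rewrite /dual_value dot_bar_m0 /conj_cost /=.
rewrite opprD addrA !EFinB -!sumEFin; congr (_ - _ - _)%E.
  by apply: eq_bigr => t _; exact/(fenchelE (phi_proper hd t))/Dphi.
by apply: eq_bigr => s _; exact/(fenchelE (costF_proper hd s))/DF.
Qed.

Lemma dual_value_notin_conj_dom u gP : ~ conj_dom d gP -> dual_value d (u, gP) = -oo%E.
Proof.
case: gP => g P ND; rewrite /dual_value.
have pN t : (phi_conj d t (P t) != -oo)%E by rewrite -ltNye; exact/fenchel_gtNy/phi_proper.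
have FN s : (costF_conj d s (at_time g s) != -oo)%E.
  by rewrite -ltNye; exact/fenchel_gtNy/costF_proper.
suff [->|->] : (\sum_t phi_conj d t (P t))%E = +oo%E \/
    (\sum_s costF_conj d s (at_time g s))%E = +oo%E.
- have : (\sum_s costF_conj d s (at_time g s) != -oo)%E.
    by apply: contraTneq isT => /eqP; rewrite esum_eqNy => /existsP[s /andP[_]]; rewrite (negbTE (FN s)).
  by case: (\sum_s _)%E.
- have : (\sum_t phi_conj d t (P t) != -oo)%E.
    by apply: contraTneq isT => /eqP; rewrite esum_eqNy => /existsP[s /andP[_]]; rewrite (negbTE (pN s)).
  by case: (\sum_t _)%E.
apply: contrapT => H; apply: ND; split=> [t|s]; rewrite ltey; apply/eqP => E;
  apply: H; [left|right]; apply/eqP; rewrite esum_eqy//; apply/existsP.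
  by exists t; rewrite /= E eqxx.
by exists s; rewrite /= E eqxx.
Qed.

Lemma saddle_dual_solution u gP ab l : saddle u gP ab l -> dual_solution d (u, gP).
Proof.
move=> [res0 [C1 [D C2] [Q C3]]]; split.
  by apply/dual_feasibleE; have /residual_dual_slack <- := res0.
move=> [u' gP'] /dual_feasibleE Q'.
have [D'|/dual_value_notin_conj_dom ->] := pselect (conj_dom d gP'); last by rewrite leNye.
rewrite !dual_valueE// lee_fin.
have res0' : residual d u' gP' (dual_slack u' gP') = 0 by exact/residual_dual_slack.
have := C2 _ D'; have := C3 _ Q'; have := C1 u; have := C1 u'.
have := congr1 (dotR l) res0; have := congr1 (dotR l) res0'.
by rewrite !residualE !dotRE; lra.
Qed.

End SaddlePoints.

(** * Saddle points solve the primal problem *)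

(** A maximum over a product is attained factor by factor. *)
Lemma le_of_sum_le (R : realType) (I : finType) (S : I -> set R) (c : I -> R) :
  (forall i, S i (c i)) ->
  (forall y : I -> R, (forall i, S i (y i)) -> \sum_i y i <= \sum_i c i) ->
  forall i y, S i y -> y <= c i.
Proof.
move=> Sc le_sum i y Sy.
have := le_sum (fun j => if j == i then y else c j).
rewrite (bigD1 i)//= eqxx (eq_bigr c) => [|j /negbTE->//].
rewrite [X in _ <= X](bigD1 i)//= lerD2r; apply=> j.
by case: eqP => [->|_].
Qed.

(** Terminal value problems in discrete time. *)
Lemma backward_recursion (X : Type) (T : nat) (xT : X) (G : 'I_T -> X -> X) :
  exists v : 'I_T.+1 -> X,
    v ord_max = xT /\ forall t, v (time_cur t) = G t (v (time_succ t)).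
Proof.
elim: T G => [|T IHT] G; first by exists (fun=> xT); split=> // -[].
have [v [vT vG]] := IHT (fun t => G (lift ord0 t)).
exists (fun s => if unlift ord0 s is Some s' then v s' else G ord0 (v ord0)).
split=> [|t].
  by rewrite (_ : ord_max = lift ord0 ord_max) ?liftK//; exact: val_inj.
rewrite liftK; case: (unliftP ord0 t) => [t' ->|->].
  rewrite (_ : time_cur _ = lift ord0 (time_cur t')) ?liftK; last exact: val_inj.
  exact: vG.
rewrite (_ : time_cur _ = ord0) ?unlift_none; last exact: val_inj.
by [].
Qed.

Section PrimalSolution.
Variables (R : realType) (T n : nat) (d : mfc_data R T n).
Hypothesis hd : standing_assumption d.
Local Notation spaceR := (spaceR R T n).
Local Notation spaceU := (spaceU R T n).
Implicit Types (u m : spaceTbS R T n) (w : spaceTSS R T n) (P : spaceT R T).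
Implicit Types (gP : spaceU) (ab l : spaceR).

(** The perspective of ell(t, x, .) is the support function of the set of the
    (a, b) allowed by Q at (t, x): this inequality and the converse one for
    maximizers, [saddle_perspective_le]. *)
Lemma perspective_ge ab t x theta z : setQ d ab ->
  ((theta * ab.1 (time_cur t, x) + dot z (at_state ab.2 t x))%R%:E
    <= perspective d t x theta z)%E.
Proof.
move=> Q; rewrite /perspective; case: ifPn => [th0|_]; last first.
  case: ifPn => [/andP[/eqP -> /eqP ->]|_]; last by rewrite leey.
  by rewrite dot0l mul0r addr0.
have [fz|] := boolP (ell d t x (theta^-1 *: z) < +oo)%E; last first.
  by rewrite ltey negbK => /eqP ->; rewrite gt0_muley ?leey// lte_fin.
rewrite (eproper_fineE (ell_proper hd t x) fz) -EFinM lee_fin.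
have := ler_wpM2l (ltW th0) (setQ_young hd Q fz).
by rewrite dotZr mulrDr mulVKf ?gt_eqF// dotC addrC.
Qed.

(** Maximality forces theta = l.1 (t, x) to be nonnegative, since a may decrease
    freely, and z = l.2 (t, x, .) to vanish when theta = 0, since b is then
    free.  When theta > 0 it says that z / theta attains the Fenchel-Young
    equality. *)
Lemma saddle_perspective_le ab l t x : setQ d ab ->
  (forall ab', setQ d ab' -> dotR l (A3 ab) <= dotR l (A3 ab')) ->
  (perspective d t x (l.1 (time_cur t, x)) (at_state l.2 t x) <=
   (l.1 (time_cur t, x) * ab.1 (time_cur t, x)
     + dot (at_state l.2 t x) (at_state ab.2 t x))%R%:E)%E.
Proof.
move=> Q Qmin.
have pairE ab' : setQ d ab' -> dotR l ab' = \sum_(i : 'I_T * 'I_n)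
   (l.1 (time_cur i.1, i.2) * ab'.1 (time_cur i.1, i.2)
     + dot (at_state l.2 i.1 i.2) (at_state ab'.2 i.1 i.2)).
  move=> /(setQP hd)[_ aT]; rewrite /dotR dot_time_cur// dot_at_state.
  rewrite -big_split/=; under eq_bigr do rewrite -big_split/=.
  exact: pair_bigA.
(* Q is a product over (t, x), so maximality over Q separates. *)
have loc a' b' : (ell_conj d t x b' <= (- a')%R%:E)%E ->
    l.1 (time_cur t, x) * a' + dot (at_state l.2 t x) b' <=
    l.1 (time_cur t, x) * ab.1 (time_cur t, x)
     + dot (at_state l.2 t x) (at_state ab.2 t x).
  move=> ab'Q.
  pose S (i : 'I_T * 'I_n) := [set l.1 (time_cur i.1, i.2) * c.1
     + dot (at_state l.2 i.1 i.2) c.2 | c in [set c : R * spaceS R n |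
       (ell_conj d i.1 i.2 c.2 <= (- c.1)%R%:E)%E]].
  apply: (@le_of_sum_le R _ S (fun i => l.1 (time_cur i.1, i.2) * ab.1 (time_cur i.1, i.2)
     + dot (at_state l.2 i.1 i.2) (at_state ab.2 i.1 i.2)) _ _ (t, x)).
  - move=> [t' x']; exists (ab.1 (time_cur t', x'), at_state ab.2 t' x') => //=.
    by have /(setQP hd)[] := Q.
  - move=> y Sy; rewrite -pairE//.
    have /choice[c cP] i : exists c : R * spaceS R n,
        (ell_conj d i.1 i.2 c.2 <= (- c.1)%R%:E)%E /\ 
         l.1 (time_cur i.1, i.2) * c.1 + dot (at_state l.2 i.1 i.2) c.2 = y i.
      by have [c c1 c2] := Sy i; exists c.
    pose ab' : spaceR := ([ffun i => if unlift ord_max i.1 is Some t'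
       then (c (t', i.2)).1 else 0], [ffun i => (c i.1).2 i.2]).
    have a'E t' x' : ab'.1 (time_cur t', x') = (c (t', x')).1.
      rewrite ffunE/= (_ : time_cur t' = lift ord_max t') ?liftK//.
      by apply: val_inj; rewrite /= /bump leqNgt ltn_ord.
    have b'E t' x' : at_state ab'.2 t' x' = (c (t', x')).2.
      by apply/ffunP => y'; rewrite !ffunE.
    have Q' : setQ d ab'.
      apply/(setQP hd); split=> [t' x'|x']; last by rewrite ffunE/= unlift_none.
      by rewrite a'E b'E; exact: (cP (t', x')).1.
    have := Qmin _ Q'; rewrite !A3E !dotRE lerN2; apply: le_trans.
    rewrite pairE//; apply: ler_sum => -[t' x'] _.
    by rewrite a'E b'E (cP (t', x')).2.
  - by exists (a', b').
have cfin b := fenchelE (ell_proper hd t x) (ell_conj_finite hd t x b).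
have Qtx : (ell_conj d t x (at_state ab.2 t x) <= (- ab.1 (time_cur t, x))%R%:E)%E.
  by have /(setQP hd)[] := Q.
move: loc; set th := l.1 _; set z := at_state l.2 t x.
set a := ab.1 _; set b := at_state ab.2 t x => loc.
rewrite /perspective; have [th0|th0|th0] := ltgtP 0 th.
- rewrite -lee_pdivlMl//.
  rewrite -EFinM; apply: biconjugate_le (ell_pcl hd t x) _ => p c pc.
  have := loc (- c) p; rewrite opprK => /(_ pc).
  rewrite dotZr dotC => h; rewrite ler_pdivlMl//.
  by rewrite mulrBr mulrA divff ?gt_eqF// mul1r; lra.
- have := loc (a - 1) b; have -> : (ell_conj d t x b <= (- (a - 1))%R%:E)%E.
    by apply: le_trans Qtx _; rewrite lee_fin /a; lra.
  by move=> /(_ isT) h; exfalso; move: h; rewrite mulrBr mulr1; lra.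
- have : dot z z <= 0.
    have := loc (- fine (ell_conj d t x (b + z))) (b + z).
    rewrite opprK {1}/ell_conj {1}cfin lexx => /(_ isT).
    by rewrite -th0 !mul0r !add0r dotDr; lra.
  move=> zz; have /eqP : dot z z = 0 by apply/eqP; rewrite eq_le zz dot_ge0.
  move=> /eqP z0; have {}z0 : z = 0 by apply: enorm_eq0; rewrite /enorm z0 sqrtr0.
  by rewrite z0 eqxx/= -th0 dot0l mul0r addr0.
Qed.

(** Minimality in (gamma, P) separates over the times and gives the equality
    case of the Fenchel-Young inequality for each phi and F. *)
Lemma saddle_cost_le gP l : conj_dom d gP ->
  (forall gP', conj_dom d gP' ->
    conj_cost d gP + dotR l (A2 d gP) <= conj_cost d gP' + dotR l (A2 d gP')) ->
  (forall t, (phi d t (opA d l.2 t) <=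
     (gP.2 t * opA d l.2 t - fine (phi_conj d t (gP.2 t)))%R%:E)%E) /\
  (forall s, (costF d s (at_time l.1 s) <=
     (dot (at_time gP.1 s) (at_time l.1 s)
       - fine (costF_conj d s (at_time gP.1 s)))%R%:E)%E).
Proof.
move=> D Dmin.
pose S (i : 'I_T + 'I_T.+1) : set R := match i with
  | inl t => [set p * opA d l.2 t - fine (phi_conj d t p)
             | p in [set p | (phi_conj d t p < +oo)%E]]
  | inr s => [set dot p (at_time l.1 s) - fine (costF_conj d s p)
             | p in [set p | (costF_conj d s p < +oo)%E]] end.
pose val gP' (i : 'I_T + 'I_T.+1) : R := match i with
  | inl t => gP'.2 t * opA d l.2 t - fine (phi_conj d t (gP'.2 t))
  | inr s => dot (at_time gP'.1 s) (at_time l.1 s)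
       - fine (costF_conj d s (at_time gP'.1 s)) end.
have valE gP' : \sum_i val gP' i = - (conj_cost d gP' + dotR l (A2 d gP')).
  rewrite big_sumType/= !sumrB /conj_cost /dotR /A2/= !dotNr -dot_opA.
  rewrite (dotC l.1) dot_at_time.
  rewrite (_ : \sum_t gP'.2 t * opA d l.2 t = dot (opA d l.2) gP'.2); first by ring.
  by apply: eq_bigr => t _; rewrite mulrC.
have loc := @le_of_sum_le R _ S (val gP) _ _.
have {}loc i y : S i y -> y <= val gP i.
  apply: loc => [j|y' Sy'].
    by case: j => [t|s]; [exists (gP.2 t) => //; exact: D.1
                         |exists (at_time gP.1 s) => //; exact: D.2].
  have /choice[p pP] t : exists p, (phi_conj d t p < +oo)%E /\
      p * opA d l.2 t - fine (phi_conj d t p) = y' (inl t).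
    by have [p ? ?] := Sy' (inl t); exists p.
  have /choice[g gg] s : exists p, (costF_conj d s p < +oo)%E /\
      dot p (at_time l.1 s) - fine (costF_conj d s p) = y' (inr s).
    by have [p' ? ?] := Sy' (inr s); exists p'.
  pose gP' : spaceU := ([ffun i => g i.1 i.2], [ffun t => p t]).
  have gE s : at_time gP'.1 s = g s by apply/ffunP => x; rewrite !ffunE.
  have D' : conj_dom d gP'.
    by split=> [t|s]; [rewrite ffunE; exact: (pP t).1 | rewrite gE; exact: (gg s).1].
  have := Dmin _ D'; rewrite -lerN2 -!valE; apply: le_trans.
  apply: ler_sum => -[t|s] _ /=; first by rewrite ffunE (pP t).2.
  by rewrite gE (gg s).2.
split=> [t|s].
- apply: biconjugate_le_line (phi_pcl hd t) _ => p c pc.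
  have fin : (phi_conj d t p < +oo)%E by exact: le_lt_trans pc (ltry _).
  apply: le_trans (loc (inl t) _ _); last by exists p.
  move: pc; rewrite (fenchelE (phi_proper hd t) fin) lee_fin /phi_conj; lra.
- apply: biconjugate_le (costF_pcl hd s) _ => p c pc.
  have fin : (costF_conj d s p < +oo)%E by exact: le_lt_trans pc (ltry _).
  apply: le_trans (loc (inr s) _ _); last by exists p.
  move: pc; rewrite (fenchelE (costF_proper hd s) fin) lee_fin /costF_conj; lra.
Qed.

(** The dual value as a sum of one Fenchel-Young lower bound per term of the
    primal cost. *)
Lemma dual_value_split u gP ab m w :
  residual d u gP ab = 0 -> setQ d ab -> m = opS w + bar_m0 d ->
  dot (bar_m0 d) u - conj_cost d gP =
  \sum_t \sum_x (m (time_cur t, x) * ab.1 (time_cur t, x)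
       + dot (at_state w t x) (at_state ab.2 t x))
  + \sum_t (gP.2 t * opA d w t - fine (phi_conj d t (gP.2 t)))
  + \sum_s (dot (at_time gP.1 s) (at_time m s)
            - fine (costF_conj d s (at_time gP.1 s))).
Proof.
move=> res0 Q mE.
have := @residual0_pairing _ _ _ d u gP ab m w 0 0 0 res0.
rewrite !addr0 !dot0l !addr0 => /(_ mE) <-.
rewrite /conj_cost !sumrB -dot_at_time (dotC gP.1).
under [in RHS]eq_bigr do rewrite big_split/=.
rewrite big_split/= -dot_at_state -dot_time_cur; last by have /(setQP hd)[] := Q.
rewrite (_ : \sum_t gP.2 t * opA d w t = dot (opA d w) gP.2); first by ring.
by apply: eq_bigr => t _; rewrite mulrC.
Qed.

Lemma weak_duality u gP ab (z : spaceC R T n) :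
  residual d u gP ab = 0 -> conj_dom d gP -> setQ d ab -> primal_feasible d z ->
  ((dot (bar_m0 d) u - conj_cost d gP)%R%:E <= primal_cost d z)%E.
Proof.
case: z => [[[m w] m2] D] res0 [Dphi DF] Q [/= mE <- <-].
have {}mE : m = opS w + bar_m0 d.
  by move/eqP: mE; rewrite addrAC subr_eq0 => /eqP.
rewrite (dual_value_split res0 Q mE).
rewrite 2!EFinD -!sumEFin; apply: leeD; first apply: leeD.
  - apply: lee_sum => t _; rewrite -sumEFin; apply: lee_sum => x _.
    exact: perspective_ge.
  - apply: lee_sum => t _.
    have [fz|] := boolP (phi d t (opA d w t) < +oo)%E; last first.
      by rewrite ltey negbK => /eqP ->; rewrite leey.
    rewrite (eproper_fineE (phi_proper hd t) fz) lee_fin.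
    by have := fenchel_young (phi_proper hd t) (Dphi t) fz; rewrite /phi_conj; lra.
  - apply: lee_sum => s _.
    have [fz|] := boolP (costF d s (at_time m s) < +oo)%E; last first.
      by rewrite ltey negbK => /eqP ->; rewrite leey.
    rewrite (eproper_fineE (costF_proper hd s) fz) lee_fin.
    by have := fenchel_young (costF_proper hd s) (DF s) fz; rewrite /costF_conj; lra.
Qed.

(** Stationarity in u is the state equation; the other two blocks make all the
    inequalities of [weak_duality] equalities. *)
Lemma saddle_primal_solution u gP ab l : saddle d u gP ab l ->
  primal_solution d (l.1, l.2, l.1, opA d l.2).
Proof.
move=> [res0 [C1 [D C2] [Q C3]]].
have mE : l.1 = opS l.2 + bar_m0 d.
  suff : l.1 - opS l.2 - bar_m0 d = 0.
    by move/eqP; rewrite -addrA -opprD subr_eq0 => /eqP.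
  apply: enorm_eq0; rewrite /enorm; set h := (X in dot X _).
  have := C1 h; rewrite /dotR/= dotNr -dot_opS => E.
  by rewrite {1}/h !dotDl !dotNl -[X in Num.sqrt X]/(_ - _) E subrr sqrtr0.
have feas : primal_feasible d (l.1, l.2, l.1, opA d l.2).
  by split=> //; rewrite {1}mE opprD addrA subrr sub0r addNr.
split=> // z' feas'.
apply: le_trans (weak_duality res0 D Q feas').
have [phile Fle] := saddle_cost_le D C2.
rewrite (dual_value_split res0 Q mE).
rewrite 2!EFinD -!sumEFin; apply: leeD; first apply: leeD.
  - apply: lee_sum => t _; rewrite -sumEFin; apply: lee_sum => x _.
    exact: saddle_perspective_le.
  - by apply: lee_sum => t _; exact: phile.
  - by apply: lee_sum => s _; exact: Fle.
Qed.

End PrimalSolution.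

(** * Existence of saddle points *)

Section Existence.
Variables (R : realType) (T n : nat) (d : mfc_data R T n).
Hypothesis hd : standing_assumption d.
Local Notation spaceR := (spaceR R T n).
Local Notation spaceU := (spaceU R T n).
Implicit Types (u m : spaceTbS R T n) (w : spaceTSS R T n) (P : spaceT R T).
Implicit Types (gP : spaceU) (ab l : spaceR).

(** (gamma, P) being fixed, u and (a, b) are found backward in time: u(t + 1)
    determines b(t), then a(t) = - ell^*(b(t)) determines u(t). *)
Lemma residual_surjective gP (h : spaceR) :
  exists u ab, setQ d ab /\ residual d u gP ab = h.
Proof.
pose bt t (v : 'I_n -> R) x : spaceS R n := 
  [ffun y => - opA_adj d gP.2 (t, x, y) - v y - h.2 (t, x, y)].
have [v [vT vG]] := @backward_recursion ('I_n -> R) T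
  (fun x => gP.1 (ord_max, x) + h.1 (ord_max, x))
  (fun t v x => gP.1 (time_cur t, x) + h.1 (time_cur t, x)
     - fine (ell_conj d t x (bt t v x))).
pose u : spaceTbS R T n := [ffun i => v i.1 i.2].
pose a : spaceTbS R T n := u - gP.1 - h.1.
pose b : spaceTSS R T n := - opA_adj d gP.2 - opS_adj u - h.2.
exists u, (a, b); split; last first.
  by rewrite /residual /a /b/= !subKr; case: (h).
apply/(setQP hd); split=> [t x|x]; last first.
  by rewrite /= !ffunE/= vT; ring.
rewrite (_ : at_state _ t x = bt t (v (time_succ t)) x); last first.
  by apply/ffunP => y; rewrite !ffunE.
rewrite /= !ffunE/= vG /ell_conj (fenchelE (ell_proper hd t x) (ell_conj_finite hd t x _)).
by rewrite lee_fin /ell_conj; lra.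
Qed.

(** The cost of any point that is feasible for the perturbed primal problem gives
    an affine upper bound on (u, gamma, P) in terms of the dual cost.  The state
    equation perturbs the times t + 1 with a sign opposite to that of time 0,
    whence the sign changes in e. *)
Lemma perturbed_weak_duality (pi : spaceTSS R T n) (e m m2 : spaceTbS R T n)
    (e2 : spaceTbS R T n) (D e3 : spaceT R T) :
  (forall t x, edom (ell d t x) (at_state pi t x)) ->
  state_equation d [ffun i => if i.1 == ord0 then e i else - e i] m pi ->
  m2 = m + e2 ->
  (forall t, D t = \sum_x \sum_y
     m (time_cur t, x) * pi (t, x, y) * alpha d (t, x, y) + e3 t) ->
  (forall i, 0 <= m i) -> (forall s, edom (costF d s) (at_time m2 s)) ->
  (forall t, edom (phi d t) (D t)) ->
  exists c : R, forall u gP ab, residual d u gP ab = 0 -> conj_dom d gP -> setQ d ab ->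
    dot e u + dot e2 gP.1 + dot e3 gP.2 <= c + (conj_cost d gP - dot (bar_m0 d) u).
Proof.
move=> pidom [st0 stS] m2E DE m_ge0 Fdom phidom.
pose w : spaceTSS R T n := [ffun i => m (time_cur i.1.1, i.1.2) * pi i].
have mE : m = opS w + bar_m0 d + e.
  apply/ffunP => -[s x]; rewrite !ffunE/=.
  case: (unliftP ord0 s) => [t ->|->].
    have := stS t x; rewrite ffunE /time_succ /= opprK => ->.
    rewrite addr0; congr (_ + _).
    by apply: eq_bigr => y _; rewrite ffunE.
  by rewrite eqxx add0r; have := st0 x; rewrite ffunE/= => <-; rewrite subrK.
have DwE : D = opA d w + e3.
  apply/ffunP => t; rewrite DE !ffunE; congr (_ + _).
  by apply: eq_bigr => x _; apply: eq_bigr => y _; rewrite ffunE.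
exists (\sum_t \sum_x m (time_cur t, x) * fine (ell d t x (at_state pi t x))
  + \sum_t fine (phi d t (D t)) + \sum_s fine (costF d s (at_time m2 s))).
move=> u gP ab res0 [Dphi DF] Q.
have := residual0_pairing e2 e3 res0 mE; rewrite -m2E -DwE.
have L1 : dot m ab.1 + dot w ab.2 <=
    \sum_t \sum_x m (time_cur t, x) * fine (ell d t x (at_state pi t x)).
  rewrite dot_time_cur; last by have /(setQP hd)[] := Q.
  rewrite dot_at_state -big_split/=; apply: ler_sum => t _.
  rewrite -big_split/=; apply: ler_sum => x _.
  have := ler_wpM2l (m_ge0 (time_cur t, x)) (setQ_young hd Q (pidom t x)).
  rewrite (_ : at_state w t x = m (time_cur t, x) *: at_state pi t x).
    by rewrite dotZl mulrDr dotC addrC.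
  by apply/ffunP => y; rewrite !ffunE.
have L2 : dot D gP.2 <= \sum_t fine (phi_conj d t (gP.2 t)) +
    \sum_t fine (phi d t (D t)).
  rewrite -big_split; apply: ler_sum => t _; rewrite mulrC.
  exact: (fenchel_young (phi_proper hd t) (Dphi t) (phidom t)).
have L3 : dot m2 gP.1 <= \sum_s fine (costF_conj d s (at_time gP.1 s)) +
    \sum_s fine (costF d s (at_time m2 s)).
  rewrite dotC dot_at_time -big_split; apply: ler_sum => s _.
  exact: (fenchel_young (costF_proper hd s) (DF s) (Fdom s)).
by rewrite /conj_cost; move: L1 L2 L3; lra.
Qed.

Hypothesis hq : qualification d.

Lemma qualification_bound : exists2 a0 : R, 0 < a0 &
  forall e e2 e3, dot e e + dot e2 e2 + dot e3 e3 <= a0 ^+ 2 ->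
  exists c : R, forall u gP ab, residual d u gP ab = 0 -> conj_dom d gP -> setQ d ab ->
    dot e u + dot e2 gP.1 + dot e3 gP.2 <= c + (conj_cost d gP - dot (bar_m0 d) u).
Proof.
have [a0 a00 H] := hq; exists a0 => // e e2 e3 e_le.
pose e' : spaceTbS R T n := [ffun i => if i.1 == ord0 then e i else - e i].
have e'e : dot e' e' = dot e e.
  by apply: eq_bigr => i _; rewrite ffunE; case: ifP => // _; rewrite mulrNN.
have [|pi [m [m2 [D [H1 H2 H3 H4 [H5 H6 H7]]]]]] := H (e', (e2, e3)).
  rewrite /enormK/= e'e -(ler_pXn2r (ltn0Sn 1)) ?nnegrE ?sqrtr_ge0 ?(ltW a00)//.
  by rewrite sqr_sqrtr ?e_le ?addr_ge0 ?dot_ge0.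
exact: (perturbed_weak_duality H1 H2 H3 H4 H5 H6 H7).
Qed.

Let feasible (x : spaceTbS R T n * spaceU) := conj_dom d x.2 /\ setQ d (dual_slack d x.1 x.2).
Let cost (x : spaceTbS R T n * spaceU) := conj_cost d x.2 - dot (bar_m0 d) x.1.

Definition unit_vec (A : finType) (i : A) (a : R) : fspace R A :=
  [ffun j => if j == i then a else 0].

Lemma dot_unit_vec (A : finType) (i : A) a (f : fspace R A) :
  dot (unit_vec i a) f = a * f i.
Proof.
rewrite /dot (bigD1 i)//= big1 ?addr0 ?ffunE ?eqxx// => j /negbTE ji.
by rewrite ffunE ji mul0r.
Qed.

(** Perturbations by +- a0 times a unit vector bound the coordinates one by
    one. *)
Lemma sublevel_bounded (C : R) :
  [/\ forall i, exists M, forall x, feasible x -> cost x <= C -> `|x.1 i| <= M,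
      forall i, exists M, forall x, feasible x -> cost x <= C -> `|x.2.1 i| <= M &
      forall t, exists M, forall x, feasible x -> cost x <= C -> `|x.2.2 t| <= M].
Proof.
have [a0 a00 bound] := qualification_bound.
have two c c' (y : spaceTbS R T n * spaceU -> R) :
    (forall x, feasible x -> a0 * y x <= c + cost x) ->
    (forall x, feasible x -> - a0 * y x <= c' + cost x) ->
    exists M, forall x, feasible x -> cost x <= C -> `|y x| <= M.
  move=> H1 H2; exists ((`|c| + `|c'| + C) / a0) => x fx Cx.
  rewrite ler_pdivlMr// -{1}(gtr0_norm a00) -normrM mulrC ler_norml.
  have := ler_norm c; have := ler_norm c'; have := normr_ge0 c; have := normr_ge0 c'.
  by have := H1 _ fx; have := H2 _ fx; rewrite mulNr => *; apply/andP; split; lra.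
have res x : residual d x.1 x.2 (dual_slack d x.1 x.2) = 0 by exact/residual_dual_slack.
split=> i.
- have [|c cP] := bound (unit_vec i a0) 0 0.
    by rewrite dot_unit_vec !dot0l ffunE eqxx !addr0 -expr2.
  have [|c' c'P] := bound (unit_vec i (- a0)) 0 0.
    by rewrite dot_unit_vec !dot0l ffunE eqxx !addr0 mulrNN -expr2.
  apply: (two c c' (fun x => x.1 i)) => x [D Q].
    by have := cP _ _ _ (res x) D Q; rewrite dot_unit_vec !dot0l !addr0.
  by have := c'P _ _ _ (res x) D Q; rewrite dot_unit_vec !dot0l !addr0.
- have [|c cP] := bound 0 (unit_vec i a0) 0.
    by rewrite dot_unit_vec !dot0l ffunE eqxx addr0 add0r -expr2.
  have [|c' c'P] := bound 0 (unit_vec i (- a0)) 0.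
    by rewrite dot_unit_vec !dot0l ffunE eqxx addr0 add0r mulrNN -expr2.
  apply: (two c c' (fun x => x.2.1 i)) => x [D Q].
    by have := cP _ _ _ (res x) D Q; rewrite dot_unit_vec !dot0l addr0 add0r.
  by have := c'P _ _ _ (res x) D Q; rewrite dot_unit_vec !dot0l addr0 add0r.
- have [|c cP] := bound 0 0 (unit_vec i a0).
    by rewrite dot_unit_vec !dot0l ffunE eqxx !add0r -expr2.
  have [|c' c'P] := bound 0 0 (unit_vec i (- a0)).
    by rewrite dot_unit_vec !dot0l ffunE eqxx !add0r mulrNN -expr2.
  apply: (two c c' (fun x => x.2.2 i)) => x [D Q].
    by have := cP _ _ _ (res x) D Q; rewrite dot_unit_vec !dot0l !add0r.
  by have := c'P _ _ _ (res x) D Q; rewrite dot_unit_vec !dot0l !add0r.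
Qed.

(** Direct method: a minimizing sequence is bounded, and its cluster points are
    minimizers because Q is closed and the cost lower semicontinuous. *)
Lemma dual_attained : exists2 x, feasible x &
  forall x', feasible x' -> cost x <= cost x'.
Proof.
have [gP0 D0] := conj_dom_nonempty hd.
have [u0 [ab0 [Q0 /residual_dual_slack ab0E]]] := residual_surjective gP0 0.
pose B := [set cost x | x in feasible].
have Binf : has_inf B.
  split; first by exists (cost (u0, gP0)), (u0, gP0) => //; split=> //=; rewrite -ab0E.
  have [a0 a00 /(_ 0 0 0)[|c cP]] := qualification_bound.
    by rewrite !dot0l !addr0 sqr_ge0.
  exists (- c) => _ [x [D Q] <-].
  have := cP x.1 x.2 _ ((residual_dual_slack _ _ _ _).2 erefl) D Q.
  by rewrite !dot0l !addr0 /cost; lra.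
have hpos k : 0 < k.+1%:R^-1 :> R by rewrite invr_gt0 ltr0n.
have /choice[x xP] k : exists x, feasible x /\ cost x <= inf B + k.+1%:R^-1.
  have [_ [x fx <-] xlt] := inf_adherent (hpos k) Binf.
  by exists x; split=> //; exact: ltW.
have xC k : cost (x k) <= inf B + 1.
  by apply: le_trans (xP k).2 _; rewrite lerD2l invf_le1 ?ltr0n// ler1n.
pose J := ('I_T.+1 * 'I_n + 'I_T.+1 * 'I_n + 'I_T)%type.
pose X k (j : J) := match j with
  | inl (inl i) => (x k).1 i | inl (inr i) => (x k).2.1 i | inr t => (x k).2.2 t end.
have [b1 b2 b3] := sublevel_bounded (inf B + 1).
have [|sg sgi [l lP]] := @bounded_family_cvg R J X.
  case=> [[i|i]|t].
  - by have [M MP] := b1 i; exists M => k; exact: MP (xP k).1 (xC k).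
  - by have [M MP] := b2 i; exists M => k; exact: MP (xP k).1 (xC k).
  - by have [M MP] := b3 t; exists M => k; exact: MP (xP k).1 (xC k).
pose u' : spaceTbS R T n := [ffun i => l (inl (inl i))].
pose gP' : spaceU := ([ffun i => l (inl (inr i))], [ffun i => l (inr i)]).
have cu i : (x (sg k)).1 i @[k --> \oo] --> u' i.
  by rewrite ffunE; exact: (lP (inl (inl i))).
have cgP : coord_cvg (fun k => (x (sg k)).2) gP'.
  split=> i; rewrite ffunE; [exact: (lP (inl (inr i)))|exact: (lP (inr i))].
have Q' : setQ d (dual_slack d u' gP').
  have dabE v gP : dual_slack d v gP = A1 v + A2 d gP.
    by rewrite /dual_slack /A1 /A2; congr pair => /=; rewrite addrC.
  have [ca cb] : coord_cvg (fun k => dual_slack d (x (sg k)).1 (x (sg k)).2) (dual_slack d u' gP').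
    rewrite dabE (_ : (fun k => _) = fun k => A1 (x (sg k)).1 + A2 d (x (sg k)).2).
      by apply: coord_cvgD; [exact: coord_cvg_A1 | exact: coord_cvg_A2].
    by apply/funext => k; rewrite dabE.
  by apply: (setQ_closed hd) ca cb => k; exact: (xP (sg k)).1.2.
have [|||||D' fle] := @conj_cost_lsc _ _ _ _ hd (fun k => (x (sg k)).2) gP'
    (fun k => inf B + (sg k).+1%:R^-1 + dot (bar_m0 d) (x (sg k)).1)
    (inf B + 0 + dot (bar_m0 d) u').
- by move=> k; exact: (xP (sg k)).1.1.
- by move=> k; have := (xP (sg k)).2; rewrite /cost lerBlDr.
- exact: cgP.1.
- exact: cgP.2.
- apply: cvgD; last by apply: cvg_dot => // i; exact: cvg_cst.
  apply: cvgD; first exact: cvg_cst.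
  exact: (cvg_incr sgi cvg_harmonic).
exists (u', gP'); first by split.
move=> x' fx'; apply: (@le_trans _ _ (inf B)); first by rewrite /cost/=; lra.
by apply: ge_inf; [exact: Binf.2 | exists x'].
Qed.

(** Since the residual is onto, the constraint that it vanishes has a multiplier
    at a dual minimizer; varying one block at a time gives the optimality
    conditions. *)
Lemma saddle_exists : exists u gP ab l, saddle d u gP ab l.
Proof.
have [[us gPs] [/= Ds Qs] xmin] := dual_attained.
pose abs := dual_slack d us gPs.
have ress : residual d us gPs abs = 0 by exact/residual_dual_slack.
have [D2c f2c] := conj_cost_convex hd.
pose X := (spaceTbS R T n * spaceU * spaceR)%type.
pose J := ('I_T.+1 * 'I_n + 'I_T * 'I_n * 'I_n)%type.
pose res (x : X) := residual d x.1.1 x.1.2 x.2.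
have res_aff (x y : X) s : res (s *: x + (1 - s) *: y) = s *: res x + (1 - s) *: res y.
  by rewrite /res /residual; congr pair; apply/ffunP => i;
    rewrite !ffunE /GRing.scale/=; ring.
pose g (x : X) (j : J) := match j with inl i => (res x).1 i | inr i => (res x).2 i end.
have [|||||l lP] := @multipliers R X J [set x : X | conj_dom d x.1.2 /\ setQ d x.2]
   (fun x => conj_cost d x.1.2 - dot (bar_m0 d) x.1.1) g (cost (us, gPs)).
- move=> x y s [D Q] [D' Q'] s01.
  by split; [exact: D2c | exact: (setQ_convex hd)].
- move=> x y s [D Q] [D' Q'] s01; have := f2c _ _ _ D D' s01.
  by rewrite /= !(dotC (bar_m0 d)) dot_linl; lra.
- move=> j x y s _ _ _; rewrite /g res_aff.
  by case: j => i; rewrite /= !ffunE.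
- move=> h; pose h' : spaceR := ([ffun i => h (inl i)], [ffun i => h (inr i)]).
  have [v [ab [Q rE]]] := residual_surjective gPs h'.
  exists (v, gPs, ab) => // j; rewrite /g (_ : res _ = h' :> spaceR)//.
  by case: j => i; rewrite ffunE.
- move=> [[v gP] ab] [/= D Q] g0; apply: (xmin (v, gP)); split=> //=.
  suff /residual_dual_slack <- : residual d v gP ab = 0 by [].
  rewrite [LHS]surjective_pairing; congr pair; apply/ffunP => i; rewrite [RHS]ffunE.
    exact: (g0 (inl i)).
  exact: (g0 (inr i)).
pose lam : spaceR := ([ffun i => l (inl i)], [ffun i => l (inr i)]).
have {}lP v gP ab : conj_dom d gP -> setQ d ab ->
    cost (us, gPs) <= conj_cost d gP - dot (bar_m0 d) v + dotR lam (residual d v gP ab).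
  move=> D Q; suff -> : dotR lam (residual d v gP ab) = \sum_j l j * g (v, gP, ab) j.
    exact: lP (v, gP, ab) (conj D Q).
  by rewrite big_sumType/=; congr (_ + _); apply: eq_bigr => i _; rewrite ffunE.
have lress : dotR lam (residual d us gPs abs) = 0.
  by rewrite ress /dotR !(dotC lam.1) !(dotC lam.2) !dot0l addr0.
exists us, gPs, abs, lam; split=> //; split.
- have key h : dot (bar_m0 d) h <= dotR lam (A1 h).
    have := lP (us + h) gPs abs Ds Qs; move: lress; rewrite !residualE.
    by rewrite A1D /cost/= !dotRE !dotE; lra.
  move=> h; apply/eqP; rewrite eq_le key andbT.
  have := key (- h); rewrite A1N.
  by rewrite !dotE !dotRE lerN2.
- split=> // gP' D'; have := lP us gP' abs D' Qs.
  by move: lress; rewrite !residualE /cost/= !dotRE; lra.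
- split=> // ab' Q'; have := lP us gPs ab' Ds Q'.
  by move: lress; rewrite !residualE /cost/= !dotRE; lra.
Qed.

End Existence.

(** * One step of the algorithm *)

Lemma first_order_ge0 (R : realType) (x y : R) :
  (forall s, 0 < s <= 1 -> 0 <= s * x + s ^+ 2 * y) -> 0 <= x.
Proof.
move=> H; rewrite leNgt; apply/negP => x0.
pose K := `|x| + `|y| + 1.
have K0 : 0 < K by rewrite ltr_wpDl// addr_ge0.
pose s := - x / (2 * K).
have sK : s * K = - x / 2 by rewrite /s invfM -!mulrA mulVf ?gt_eqF// mulr1 mulrC.
have s0 : 0 < s by rewrite /s divr_gt0// ?oppr_gt0// mulr_gt0.
have s1 : s <= 1.
  have := ler_norm (- x); rewrite normrN => h.
  rewrite /s ler_pdivrMr ?mulr_gt0// mul1r /K.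
  by have := normr_ge0 y; have := normr_ge0 x; lra.
have /H : 0 < s <= 1 by rewrite s0.
rewrite expr2 -mulrA -mulrDr pmulr_rge0//.
have : s * y <= s * K.
  by rewrite ler_pM2l// /K; have := ler_norm y; have := normr_ge0 x; lra.
by rewrite sK; lra.
Qed.

Section Step.
Variables (R : realType) (T n : nat) (d : mfc_data R T n).
Hypothesis hd : standing_assumption d.
Local Notation spaceR := (spaceR R T n).
Local Notation spaceU := (spaceU R T n).
Local Notation spaceV := (spaceV R T n).
Implicit Types (u m : spaceTbS R T n) (w : spaceTSS R T n) (P : spaceT R T).
Implicit Types (gP : spaceU) (ab l mw : spaceR) (v : spaceV).

(** The squared distance to saddle points that the algorithm decreases, multiplied
    by r in order to avoid inverses. *)
Definition sqdist (r : R) (p q s : spaceR) : R :=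
  r ^+ 2 * dotR p p + r ^+ 2 * dotR q q + dotR s s.

(** Here x, y, z are the differences between the current point and a saddle point
    of, respectively, A2 (gamma, P), A3 (a, b) and the multiplier; e2, e3 and
    r q are the prediction steps of the same quantities, q being the residual of
    the prediction, and c is A2 applied to the difference of the sheared
    unknowns.  The last three hypotheses come from [optimality_monotone].  Their
    sum, completed by the square r^2 |q - e2 - e3|^2, bounds twice the inner
    product of the step with the distance to the saddle point by the opposite of
    the quadratic form of the step. *)
Lemma admg_descent (r xi : R) (c x y z e2 e3 q : spaceR) :
  0 <= r -> 0 <= xi ->
  dotR c e2 = dotR (x + y) e2 ->
  dotR (z + r *: q - r *: (e2 + e3)) (q - (x + e2) - (y + e3)) = 0 ->
  dotR (z + r *: q - r *: e3) (x + e2) <= 0 ->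
  dotR (z + r *: q) (y + e3) <= 0 ->
  sqdist r (c + xi *: e2) (y + xi *: e3) (z + xi *: (r *: q))
    <= sqdist r c y z - xi * (1 - xi) * sqdist r e2 e3 (r *: q).
Proof.
move=> r0 xi0 cE V1 V2 V3.
have sq : 0 <= r ^+ 2 * dotR (q - (e2 + e3)) (q - (e2 + e3)).
  by rewrite mulr_ge0 ?sqr_ge0 ?dotR_ge0.
have S : 2 * (r ^+ 2 * dotR c e2 + r ^+ 2 * dotR y e3 + r * dotR z q)
    + sqdist r e2 e3 (r *: q) <= 0.
  move: (congr1 ( *%R r) V1) (ler_wpM2l r0 V2) (ler_wpM2l r0 V3) sq.
  rewrite cE /sqdist !dotRE !mulr0.
  rewrite !(dotRC e2 q) !(dotRC e3 q) !(dotRC e3 e2) !(dotRC q x) !(dotRC q y).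
  rewrite ?(dotRC q z) ?(dotRC e2 x) ?(dotRC e2 y) ?(dotRC e3 x) ?(dotRC e3 y).
  by lra.
have := ler_wpM2l xi0 S; rewrite mulr0 /sqdist !dotRE.
rewrite !(dotRC e2 c) !(dotRC e3 y) !(dotRC q z) => S'.
by move: S'; lra.
Qed.

Lemma aug_lagrangian_uE r u gP ab mw : aug_lagrangian_u d r u gP ab mw =
  - dot (bar_m0 d) u + dotR mw (residual d u gP ab)
  + r / 2 * dotR (residual d u gP ab) (residual d u gP ab).
Proof. by rewrite /aug_lagrangian_u enormR_sqr dot_bar_m0 /dotR addrA. Qed.

Lemma aug_lagrangianE r u gP ab mw : conj_dom d gP -> setQ d ab ->
  aug_lagrangian d r u gP ab mw =
  (conj_cost d gP + aug_lagrangian_u d r u gP ab mw)%:E.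
Proof.
move=> D Q; rewrite /aug_lagrangian dual_valueE// /indicator mem_set// adde0.
rewrite -EFinN -!EFinD; congr EFin.
by rewrite aug_lagrangian_uE enormR_sqr /dotR; ring.
Qed.

Lemma aug_lagrangian_notin_conj_dom r u gP ab mw : ~ conj_dom d gP ->
  aug_lagrangian d r u gP ab mw = +oo%E.
Proof.
move=> ND; rewrite /aug_lagrangian dual_value_notin_conj_dom//= /indicator.
by case: ifP.
Qed.

Lemma residual_addu u h gP ab : residual d (u + h) gP ab = residual d u gP ab + A1 h.
Proof.
rewrite !residualE A1D.
by rewrite -!addrA; congr (_ + _); rewrite addrC addrA.
Qed.

Lemma residual_segment_gP u gP gP' ab s :
  residual d u (s *: gP' + (1 - s) *: gP) ab =
  residual d u gP ab + s *: (A2 d gP' - A2 d gP).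
Proof.
rewrite /residual /A2; congr pair; apply/ffunP => i;
  by rewrite /= !ffunE /GRing.scale/=; ring.
Qed.

Lemma residual_segment_ab u gP ab ab' s :
  residual d u gP (s *: ab' + (1 - s) *: ab) =
  residual d u gP ab + s *: (A3 ab' - A3 ab).
Proof.
rewrite /residual /A3; congr pair; apply/ffunP => i;
  by rewrite /= !ffunE /GRing.scale/=; ring.
Qed.

(** Each minimization uses the residual available when it is performed; compared
    with the final multiplier, this residual lacks the later updates, whence the
    shifts.  The smooth quadratic term is linearized by [first_order_ge0]. *)
Lemma admm_step_optimality r gP ab mw u gPt abt mwt :
  setQ d ab -> admm_step d r (gP, ab, mw) u (gPt, abt, mwt) ->
  optimality d (mwt - r *: (A2 d (gPt - gP) + A3 (abt - ab)))
    (mwt - r *: A3 (abt - ab)) mwt gPt abt.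
Proof.
move=> Q [[_ umin] [_ gPmin] [Qt abmin] mwtE].
have r3 : residual d u gPt abt = residual d u gPt ab + A3 (abt - ab).
  rewrite /residual /A3; congr pair; apply/ffunP => i; rewrite /= !ffunE; ring.
have r2 : residual d u gPt ab = residual d u gP ab + A2 d (gPt - gP).
  rewrite /residual /A2; congr pair; apply/ffunP => i; rewrite /= !ffunE/=; ring.
have l3E : mwt - r *: A3 (abt - ab) = mw + r *: residual d u gPt ab.
  by rewrite mwtE r3 scalerDr addrA addrK.
have l2E : mwt - r *: (A2 d (gPt - gP) + A3 (abt - ab)) = mw + r *: residual d u gP ab.
  by rewrite mwtE r3 r2 -[residual _ _ _ _ + _ + _]addrA [r *: (_ + (_ + _))]scalerDr addrA addrK.
have [gP0 D0] := conj_dom_nonempty hd.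
have Dt : conj_dom d gPt.
  apply: contrapT => /aug_lagrangian_notin_conj_dom N; have := gPmin gP0 I.
  by rewrite N aug_lagrangianE// leye_eq.
split.
- have key h : dot (bar_m0 d) h <= dotR (mw + r *: residual d u gP ab) (A1 h).
    rewrite -subr_ge0; apply: (@first_order_ge0 _ _ (r / 2 * dotR (A1 h) (A1 h))) => s _.
    have := umin (u + s *: h) I.
    rewrite lee_fin !aug_lagrangian_uE residual_addu A1Z.
    rewrite !dotRE !dotE (dotRC (A1 h) (residual _ _ _ _)); lra.
  move=> h; rewrite l2E; apply/eqP; rewrite eq_le key andbT.
  have := key (- h); rewrite A1N.
  by rewrite dotNr dotRNr lerN2.
- split=> // gP' D'; rewrite l3E -subr_ge0.
  have [D2c f2c] := conj_cost_convex hd.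
  set q := A2 d gP' - A2 d gPt.
  rewrite (_ : _ - _ = conj_cost d gP' - conj_cost d gPt + dotR (mw + r *: residual d u gPt ab) q); last first.
    by rewrite /q !dotRE; ring.
  apply: (@first_order_ge0 _ _ (r / 2 * dotR q q)) => s /andP[s0 s1].
  have s01 : 0 <= s <= 1 by rewrite ltW.
  have := gPmin (s *: gP' + (1 - s) *: gPt) I.
  rewrite !aug_lagrangianE//; last exact: D2c.
  rewrite lee_fin !aug_lagrangian_uE residual_segment_gP -/q.
  have := f2c _ _ _ D' Dt s01.
  clearbody q; rewrite !dotRE (dotRC q (residual _ _ _ _)); lra.
- split=> // ab' Q'; rewrite -subr_ge0; set q := A3 ab' - A3 abt.
  rewrite (_ : _ - _ = dotR (mw + r *: residual d u gPt abt) q); last first.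
    by rewrite /q mwtE !dotRE; ring.
  apply: (@first_order_ge0 _ _ (r / 2 * dotR q q)) => s /andP[s0 s1].
  have s01 : 0 <= s <= 1 by rewrite ltW.
  have Qs := setQ_convex hd Q' Qt s01.
  have := abmin _ Qs; rewrite !aug_lagrangianE//.
  rewrite lee_fin !aug_lagrangian_uE residual_segment_ab -/q.
  clearbody q; rewrite !dotRE (dotRC q (residual _ _ _ _)); lra.
Qed.

End Step.

(** * The correction step and Fejer monotonicity *)

Section Fejer.
Variables (R : realType) (T n : nat) (d : mfc_data R T n).
Hypothesis hd : standing_assumption d.
Hypothesis halpha : forall t, 0 < bar_alpha d t.
Local Notation spaceR := (spaceR R T n).
Local Notation spaceU := (spaceU R T n).
Local Notation spaceV := (spaceV R T n).
Implicit Types (u m : spaceTbS R T n) (w : spaceTSS R T n) (P : spaceT R T).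
Implicit Types (gP : spaceU) (ab l mw : spaceR) (v : spaceV).

(** The operator (A2^* A2)^-1 A2^* A3. *)
Definition couple ab : spaceU :=
  (ab.1, [ffun t => opA d ab.2 t / bar_alpha d t]).

Lemma A2_adj_A2E gP :
  A2_adj d (A2 d gP) = (gP.1, [ffun t => bar_alpha d t * gP.2 t]).
Proof.
rewrite /A2_adj/A2/= opprK; congr pair; apply/ffunP => t.
rewrite !ffunE /bar_alpha -sumrN mulr_suml; apply: eq_bigr => x _.
rewrite -sumrN mulr_suml; apply: eq_bigr => y _; rewrite !ffunE/=; ring.
Qed.

Lemma A2_adj_A3E ab : A2_adj d (A3 ab) = A2_adj d (A2 d (couple ab)).
Proof.
rewrite A2_adj_A2E /A2_adj /A3 /=; congr pair; first by rewrite opprK.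
apply/ffunP => t; rewrite !ffunE mulrCA mulfV ?gt_eqF// mulr1 -sumrN.
apply: eq_bigr => x _; rewrite -sumrN; apply: eq_bigr => y _.
by rewrite !ffunE mulNr opprK.
Qed.

Lemma opGE v : opG d v = (v.1.1 - couple v.1.2, v.1.2, v.2).
Proof.
case: v => -[gP ab] mw; rewrite /opG A2_adj_A3E; congr (_ - _, _, _).
rewrite -[A2_adj d _]/((A2_adj d \o A2 d) (couple ab)) pinvKV ?inE//.
by move=> x y _ _; exact: (bij_inj (A2_adj_A2_bij halpha)).
Qed.

Lemma couple_lin s ab (ab' : spaceR) :
  couple (ab + s *: ab') = couple ab + s *: couple ab'.
Proof.
rewrite /couple; congr pair; apply/ffunP => t; rewrite !ffunE /= /GRing.scale/=.
rewrite mulrA -mulrDl; congr (_ / _); rewrite mulr_sumr -big_split.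
apply: eq_bigr => x _; rewrite mulr_sumr -big_split; apply: eq_bigr => y _.
by rewrite !ffunE /GRing.scale/=; ring.
Qed.

Lemma dotR_A2 p gP : dotR p (A2 d gP) =
  dot (A2_adj d p).1 gP.1 + dot (A2_adj d p).2 gP.2.
Proof. by rewrite /dotR /A2_adj /A2 /= !dotE dot_opA. Qed.

(** The unknowns in which G becomes the identity, see [shear_step]. *)
Definition shear v : spaceV := (v.1.1 + couple v.1.2, v.1.2, v.2).

Lemma shear_step xi v (dv : spaceV) :
  shear (v + xi *: opG d dv) = shear v + xi *: dv.
Proof.
case: v dv => [[gP ab] mw] [[dgP dab] dmw]; rewrite opGE /shear/=.
by congr (_, _, _); rewrite couple_lin scalerBr addrACA subrK.
Qed.

Local Notation J := (('I_T.+1 * 'I_n + 'I_T) +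
  (('I_T.+1 * 'I_n + 'I_T * 'I_n * 'I_n) +
   ('I_T.+1 * 'I_n + 'I_T * 'I_n * 'I_n)))%type.

(** All the unknowns as one family of reals, the setting of [fejer_cvg]. *)
Definition coords v (j : J) : R := match j with
  | inl (inl i) => v.1.1.1 i | inl (inr i) => v.1.1.2 i
  | inr (inl (inl i)) => v.1.2.1 i | inr (inl (inr i)) => v.1.2.2 i
  | inr (inr (inl i)) => v.2.1 i | inr (inr (inr i)) => v.2.2 i end.

Definition of_coords (x : J -> R) : spaceV :=
  ([ffun i => x (inl (inl i))], [ffun i => x (inl (inr i))],
   ([ffun i => x (inr (inl (inl i)))], [ffun i => x (inr (inl (inr i)))]),
   ([ffun i => x (inr (inr (inl i)))], [ffun i => x (inr (inr (inr i)))])).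

Lemma of_coordsK x : coords (of_coords x) = x.
Proof. by apply/funext => -[[i|i]|[[i|i]|[i|i]]] /=; rewrite ffunE. Qed.

Lemma coordsB v v' j : coords (v - v') j = coords v j - coords v' j.
Proof. by case: j => [[i|i]|[[i|i]|[i|i]]] /=; rewrite !ffunE. Qed.

Lemma coords_cvg (v : nat -> spaceV) v' :
  (forall j, coords (v k) j @[k --> \oo] --> coords v' j) <->
  [/\ coord_cvg (fun k => (v k).1.1) v'.1.1,
      coord_cvg (fun k => (v k).1.2) v'.1.2 &
      coord_cvg (fun k => (v k).2) v'.2].
Proof.
split=> [H|[[H1 H2] [H3 H4] [H5 H6]]]; last first.
  by case=> [[i|i]|[[i|i]|[i|i]]]; [exact: H1|exact: H2|exact: H3|exact: H4
                                   |exact: H5|exact: H6].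
split; split=> i.
- exact: (H (inl (inl i))).
- exact: (H (inl (inr i))).
- exact: (H (inr (inl (inl i)))).
- exact: (H (inr (inl (inr i)))).
- exact: (H (inr (inr (inl i)))).
- exact: (H (inr (inr (inr i)))).
Qed.

(** The quadratic form [sqdist] is diagonal in these coordinates because
    A2^* A2 is. *)
Definition weight (r : R) (j : J) : R := match j with
  | inl (inr t) => r ^+ 2 * bar_alpha d t
  | inr (inr _) => 1
  | _ => r ^+ 2 end.

Lemma sqdist_coords r v :
  \sum_j weight r j * coords v j ^+ 2 =
  sqdist r (A2 d v.1.1) (A3 v.1.2) v.2.
Proof.
rewrite !big_sumType/= /sqdist dotR_A2 A2_adj_A2E /dotR /A3/= !dotE !opprK.
rewrite [in RHS]/dot !mulrDr !mulr_sumr -!addrA.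
congr (_ + (_ + (_ + (_ + (_ + _))))); apply: eq_bigr => i _; rewrite ?ffunE; ring.
Qed.

Variables (r xi : R).
Hypothesis hr : 0 < r.
Hypothesis hxi : 0 < xi < 1.

Lemma weight_gt0 j : 0 < weight r j.
Proof.
have r2 : 0 < r ^+ 2 by rewrite exprn_gt0.
by case: j => [[i|i]|[[i|i]|[i|i]]] //=; rewrite mulr_gt0.
Qed.

(** [admg_descent] for the sheared unknowns; A2 (shear v).1.1 and
    A2 (gamma, P) + A3 (a, b) have the same inner product with the range of A2,
    which is the first hypothesis there. *)
Lemma admm_step_fejer v u vt us gPs abs ls :
  setQ d v.1.2 -> admm_step d r v u vt -> saddle d us gPs abs ls ->
  \sum_j weight r j * (coords (shear v + xi *: (vt - v)) j
                        - coords (shear (gPs, abs, ls)) j) ^+ 2 <=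
  \sum_j weight r j * (coords (shear v) j - coords (shear (gPs, abs, ls)) j) ^+ 2
  - xi * (1 - xi) * \sum_j weight r j * coords (vt - v) j ^+ 2.
Proof.
case: v vt => [[gP ab] mw] [[gPt abt] mwt] /= Q step [res0 opts].
have optt := admm_step_optimality hd Q step.
have [_ _ _ mwtE] := step.
have xi0 : 0 < xi by case/andP: hxi.
under eq_bigr do rewrite -coordsB.
under [X in _ <= X - _]eq_bigr do rewrite -coordsB.
rewrite !sqdist_coords /=.
have dmwE : mwt - mw = r *: residual d u gPt abt by rewrite mwtE addrAC subrr add0r.
rewrite (_ : gP + couple ab + xi *: (gPt - gP) - (gPs + couple abs) =
  (gP + couple ab - (gPs + couple abs)) + xi *: (gPt - gP)); last by rewrite addrAC.
rewrite A2D A2Z !A3E.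
rewrite (_ : - (ab + xi *: (abt - ab) - abs) = - (ab - abs) + xi *: - (abt - ab)); last first.
  by rewrite scalerN -opprD addrAC.
rewrite [mw + _ - ls]addrAC dmwE.
have [V1 V2 V3] := optimality_monotone (u - us) optt opts.
have xE : A2 d (gP - gPs) + A2 d (gPt - gP) = A2 d gPt - A2 d gPs.
  by rewrite -A2D addrC addrA subrK A2B.
have yE : - (ab - abs) + - (abt - ab) = A3 abt - A3 abs.
  by rewrite !A3E -opprD addrC addrA subrK opprB opprK addrC.
have zE : mw - ls + r *: residual d u gPt abt = mwt - ls.
  by rewrite -dmwE addrC addrA subrK.
apply: (admg_descent (x := A2 d (gP - gPs))); rewrite ?(ltW hr) ?(ltW xi0)//.
- have -> : gP + couple ab - (gPs + couple abs) = (gP - gPs) + couple (ab - abs).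
    by rewrite -[- abs]scaleN1r couple_lin scaleN1r opprD addrACA.
  rewrite A2D !dotRDl; congr (_ + _).
  by rewrite -A3E dotR_A2 [RHS]dotR_A2 A2_adj_A3E.
- rewrite xE yE zE -[- (abt - ab)]A3E; rewrite addrAC in V1; apply: etrans V1; congr dotR.
  have abel (p q s p' q' s' : spaceR) :
      p + q + s - (q - q') - (s - s') = p - p' + (p' + q' + s').
    by rewrite [LHS]surjective_pairing; congr pair; apply/ffunP => i;
      rewrite /= !ffunE; ring.
  by rewrite A1D A1N residualE (abel _ _ _ (A1 us)) -residualE res0 addr0.
- by rewrite xE zE -[- (abt - ab)]A3E addrAC.
- by rewrite yE zE.
Qed.

End Fejer.

(** * Convergence *)

Lemma cvgn_pair (U V : topologicalType) (f : nat -> U) (g : nat -> V) (x : U) (y : V) :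
  f @ \oo --> x -> g @ \oo --> y -> (fun k => (f k, g k)) @ \oo --> (x, y).
Proof. by move=> fx gy; exact: (cvg_pair fx gy). Qed.

Section Limit.
Variables (R : realType) (T n : nat) (d : mfc_data R T n).
Hypothesis hd : standing_assumption d.
Hypothesis halpha : forall t, 0 < bar_alpha d t.
Local Notation spaceR := (spaceR R T n).
Local Notation spaceU := (spaceU R T n).
Local Notation spaceV := (spaceV R T n).
Implicit Types (u m : spaceTbS R T n) (w : spaceTSS R T n) (P : spaceT R T).
Implicit Types (gP : spaceU) (ab l mw : spaceR) (v : spaceV).

Lemma coords_cvg_shear (v : nat -> spaceV) (x : spaceV) :
  (forall j, coords (shear d (v k)) j @[k --> \oo] --> coords (shear d x) j) ->
  forall j, coords (v k) j @[k --> \oo] --> coords x j.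
Proof.
move=> /coords_cvg[c1 c2 c3]; apply/coords_cvg; split=> //.
rewrite /= in c1 c2 c3.
have -> : x.1.1 = x.1.1 + couple d x.1.2 - couple d x.1.2 by rewrite addrK.
have -> : (fun k => (v k).1.1) =
    fun k => (v k).1.1 + couple d (v k).1.2 - couple d (v k).1.2.
  by apply/funext => k; rewrite addrK.
apply: coord_cvgB => //; have [ca cb] := c2; split=> i /=; first exact: ca.
rewrite ffunE; under eq_fun do rewrite ffunE.
apply: cvgMr_tmp; rewrite ffunE; under eq_fun do rewrite ffunE.
by apply: cvg_sumr => y; apply: cvg_sumr => z; apply: cvgMr_tmp; exact: cb.
Qed.

(** As the steps vanish, the predictions have the same limit as the iterates and
    the shifts of the multipliers disappear.  The iterates u follow the others
    because u = gamma + a up to the residual. *)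
Lemma limit_saddle (r : R) (v vt : nat -> spaceV) (u : nat -> spaceTbS R T n) v' :
  0 < r ->
  (forall k, setQ d (v k).1.2) -> (forall k, admm_step d r (v k) (u k) (vt k)) ->
  (forall j, coords (vt k - v k) j @[k --> \oo] --> 0) ->
  (forall j, coords (v k) j @[k --> \oo] --> coords v' j) ->
  exists2 u', saddle d u' v'.1.1 v'.1.2 v'.2 &
    forall i, u k i @[k --> \oo] --> u' i.
Proof.
move=> r0 Q step dv cv.
have [e1 e2 e3] : [/\ coord_cvg (fun k => (vt k).1.1 - (v k).1.1) 0,
   coord_cvg (fun k => (vt k).1.2 - (v k).1.2) 0 &
   coord_cvg (fun k => (vt k).2 - (v k).2) 0].
  apply/(@coords_cvg _ _ _ (fun k => vt k - v k) 0) => j.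
  rewrite (_ : coords 0 j = 0); first exact: dv.
  by case: j => [[i|i]|[[i|i]|[i|i]]]; rewrite /= ffunE.
have /coords_cvg[t1 t2 t3] : forall j, coords (vt k) j @[k --> \oo] --> coords v' j.
  move=> j; rewrite -[X in _ --> X]add0r.
  rewrite (_ : (fun k => _) = fun k => coords (vt k - v k) j + coords (v k) j).
    exact: cvgD (dv j) (cv j).
  by apply/funext => k; rewrite coordsB subrK.
have resE k : residual d (u k) (vt k).1.1 (vt k).1.2 = r^-1 *: ((vt k).2 - (v k).2).
  case: (v k) (vt k) (step k) => [[gP ab] mw] [[gPt abt] mwt] [_ _ _ ->] /=.
  by rewrite addrAC subrr add0r scalerA mulVf ?gt_eqF// scale1r.
have res0 : coord_cvg (fun k => residual d (u k) (vt k).1.1 (vt k).1.2) 0.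
  rewrite (_ : (fun k => _) = fun k => r^-1 *: ((vt k).2 - (v k).2)).
    by have := coord_cvgZ r^-1 e3; rewrite scaler0.
  by apply/funext => k.
pose u' := v'.1.1.1 + v'.1.2.1.
have cu i : u k i @[k --> \oo] --> u' i.
  rewrite (_ : (fun k => u k i) = fun k => (residual d (u k) (vt k).1.1 (vt k).1.2).1 i
      + ((vt k).1.1.1 i + (vt k).1.2.1 i)); last first.
    by apply/funext => k; rewrite /= !ffunE; ring.
  rewrite (_ : u' i = (0 : spaceR).1 i + (v'.1.1.1 i + v'.1.2.1 i)); last first.
    by rewrite /u' !ffunE add0r.
  by apply: cvgD; [exact: res0.1 | apply: cvgD; [exact: t1.1 | exact: t2.1]].
exists u' => //; split.
  have [r1 r2] : coord_cvg (fun k => residual d (u k) (vt k).1.1 (vt k).1.2)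
      (residual d u' v'.1.1 v'.1.2).
    rewrite residualE (_ : (fun k => _) =
      fun k => A1 (u k) + A2 d (vt k).1.1 + A3 (vt k).1.2).
      by apply: coord_cvgD; [apply: coord_cvgD; [exact: coord_cvg_A1
        | exact: coord_cvg_A2] | exact: coord_cvg_A3].
    by apply/funext => k; rewrite residualE.
  rewrite [LHS]surjective_pairing [RHS]surjective_pairing.
  have uniq (x : nat -> R) (y z : R) : x @ \oo --> y -> x @ \oo --> z -> y = z.
    by move=> xy xz; exact: (cvg_unique _ xy xz).
  by congr pair; apply/ffunP => i;
    [exact: uniq (r1 i) (res0.1 i) | exact: uniq (r2 i) (res0.2 i)].
have A20 : A2 d 0 = 0 by rewrite -(scale0r 0) A2Z scale0r.
apply: (optimality_lim hd (gP := fun k => (vt k).1.1) (ab := fun k => (vt k).1.2)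
  (l1 := fun k => (vt k).2 - r *: (A2 d ((vt k).1.1 - (v k).1.1)
                                    + A3 ((vt k).1.2 - (v k).1.2)))
  (l2 := fun k => (vt k).2 - r *: A3 ((vt k).1.2 - (v k).1.2))
  (l3 := fun k => (vt k).2)) => //.
- move=> k; have := step k; have := Q k.
  by case: (v k) (vt k) => [[gP ab] mw] [[gPt abt] mwt] /=; exact: admm_step_optimality.
- have -> : v'.2 = v'.2 - r *: (A2 d 0 + A3 0) by rewrite A20 A3E oppr0 addr0 scaler0 subr0.
  apply: coord_cvgB => //; apply: coord_cvgZ; apply: coord_cvgD.
    exact: coord_cvg_A2.
  exact: coord_cvg_A3.
- have -> : v'.2 = v'.2 - r *: A3 0 by rewrite A3E oppr0 scaler0 subr0.
  by apply: coord_cvgB => //; apply: coord_cvgZ; exact: coord_cvg_A3.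
Qed.

End Limit.

Unset Implicit Arguments.
Set Strict Implicit.

Theorem theorem6p7 (R : realType) (T n : nat) (hT : (0 < T)%N) (hn : (0 < n)%N)
  (d : mfc_data R T n)
  (hd : standing_assumption d) (hqual : qualification d)
  (halpha : forall t, 0 < bar_alpha d t)
  (r xi : R) (hr : 0 < r) (hxi : 0 < xi < 1)
  (u gamma : nat -> spaceTbS R T n) (P : nat -> spaceT R T)
  (a : nat -> spaceTbS R T n) (b : nat -> spaceTSS R T n)
  (m1 : nat -> spaceTbS R T n) (w : nat -> spaceTSS R T n)
  (hQ : setQ d (a 0%N, b 0%N))
  (hstep : forall k : nat,
    admg_step d r xi ((gamma k, P k), (a k, b k), (m1 k, w k))
      (u k.+1)
      ((gamma k.+1, P k.+1), (a k.+1, b k.+1), (m1 k.+1, w k.+1)))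
  (m2 : nat -> spaceTbS R T n) (hm2 : forall k, m2 k = m1 k)
  (D : nat -> spaceT R T) (hD : forall k, D k = opA d (w k)) :
  (exists z : spaceC R T n,
     primal_solution d z /\
     (fun k : nat => (m1 k, w k, m2 k, D k)) @ \oo --> z) /\
  (exists z : spaceK R T n,
     dual_solution d z /\
     (fun k : nat => (u k, (gamma k, P k))) @ \oo --> z).
Proof.
pose v k : spaceV R T n := ((gamma k, P k), (a k, b k), (m1 k, w k)).
have /choice[vt vtP] k : exists vt, admm_step d r (v k) (u k.+1) vt /\
    v k.+1 = v k + xi *: opG d (vt - v k).
  by have [ut [vt [? -> ?]]] := hstep k; exists vt.
(* xi < 1 keeps (a, b) in Q: each iterate is a convex combination of points of Q. *)
have Q k : setQ d (v k).1.2.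
  elim: k => // k Qk; have [st ->] := vtP k.
  have Qt : setQ d (vt k).1.2.
    by case: (vt k) st => [[gPt abt] mwt] [_ _ []].
  have xi01 : 0 <= xi <= 1 by case/andP: hxi => x0 x1; rewrite !ltW.
  rewrite opGE//; have := setQ_convex hd Qt Qk xi01; congr (setQ d _).
  rewrite scalerBl scale1r /= scalerBr addrCA; congr (_ + _).
have [us [gPs [abs [ls sadd]]]] := saddle_exists hd hqual.
pose dv k := vt k - v k.
have fej u' gP ab l : saddle d u' gP ab l -> forall k,
    \sum_j weight d r j * (coords (shear d (v k.+1)) j - coords (shear d (gP, ab, l)) j) ^+ 2
    <= \sum_j weight d r j * (coords (shear d (v k)) j - coords (shear d (gP, ab, l)) j) ^+ 2
       - xi * (1 - xi) * \sum_j weight d r j * coords (dv k) j ^+ 2.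
  move=> sad k; have [st ->] := vtP k; rewrite shear_step//.
  exact: (admm_step_fejer hd halpha hr hxi (Q k) st sad).
have wt0 j : 0 < weight d r j by exact: weight_gt0.
have K0 : 0 < xi * (1 - xi) by case/andP: hxi => x0 x1; rewrite mulr_gt0// subr_gt0.
have N0 k : 0 <= \sum_j weight d r j * coords (dv k) j ^+ 2.
  by apply: sumr_ge0 => j _; rewrite mulr_ge0 ?sqr_ge0// ltW.
(* One saddle point suffices to see that the prediction steps vanish. *)
have dv0 j : coords (dv k) j @[k --> \oo] --> 0.
  apply: cvg_sqr0.
  have wdv : weight d r j * coords (dv k) j ^+ 2 @[k --> \oo] --> 0.
    have := summable_decrease K0 _ N0 (fej _ _ _ _ sadd) => /(_ _)/wrap[k|Nc].
      by apply: sumr_ge0 => i _; rewrite mulr_ge0 ?sqr_ge0// ltW.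
    apply: squeeze_cvgr Nc; last exact: cvg_cst.
    near=> k; rewrite mulr_ge0 ?sqr_ge0 ?(ltW (wt0 j))//= (bigD1 j)//= lerDl.
    by apply: sumr_ge0 => i _; rewrite mulr_ge0 ?sqr_ge0// ltW.
  rewrite (_ : (fun k => _) =
    fun k => (weight d r j)^-1 * (weight d r j * coords (dv k) j ^+ 2)).
    by rewrite -(mulr0 (weight d r j)^-1); exact: cvgMl_tmp.
  by apply/funext => k; rewrite mulKf// gt_eqF.
(* The sheared iterates are Fejer monotone with respect to the sheared saddle
   points. *)
pose S := [set coords (shear d (x.1.1, x.1.2, x.2)) | x in
  [set x : spaceV R T n | exists u', saddle d u' x.1.1 x.1.2 x.2]].
have [|||_ [x [u' sad] <-] Yx] := @fejer_cvg R _ (weight d r)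
  (fun k => coords (shear d (v k))) S wt0.
- by exists (coords (shear d (gPs, abs, ls))), (gPs, abs, ls) => //; exists us.
- move=> _ [[[gP ab] l] [u' sad] <-] k; apply: le_trans (fej _ _ _ _ sad k) _.
  by rewrite lerBlDr lerDl mulr_ge0// ltW.
- move=> sg sgi y Yy; pose x := of_coords y.
  have [gP xE] : exists gP, shear d (gP, x.1.2, x.2) = x.
    by case: x => [[gP q] l]; exists (gP - couple d q); rewrite /shear/= subrK.
  have cv := @coords_cvg_shear _ _ _ d (v \o sg) (gP, x.1.2, x.2).
  have [||||u' sad _] := limit_saddle hd (v := v \o sg) (vt := vt \o sg)
    (u := fun k => u (sg k).+1) (v' := (gP, x.1.2, x.2)) hr.
  + by move=> k; exact: Q.
  + by move=> k; exact: (vtP (sg k)).1.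
  + by move=> j; exact: (cvg_incr sgi (dv0 j)).
  + by apply: cv => j; rewrite xE of_coordsK; exact: Yy.
  by exists (gP, x.1.2, x.2); [exists u' | rewrite xE of_coordsK].
have vx : forall j, coords (v k) j @[k --> \oo] --> coords x j.
  by apply: (@coords_cvg_shear _ _ _ d); case: (x) Yx => -[].
have [|u2 sad2 cu] := limit_saddle hd (v := v) (vt := vt)
    (u := fun k => u k.+1) (v' := x) hr Q _ dv0 vx.
  by move=> k; exact: (vtP k).1.
have /coords_cvg[[cg cP] _ [cm cw]] := vx.
split.
- exists (x.2.1, x.2.2, x.2.1, opA d x.2.2); split.
    exact: saddle_primal_solution sad2.
  have cm' : m1 @ \oo --> x.2.1 by apply: cvg_fspace.
  apply: cvgn_pair; last first.
    rewrite (_ : D = fun k => opA d (w k)); last exact/funext.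
    apply: cvg_fspace => t; rewrite ffunE; under eq_fun do rewrite ffunE.
    by apply: cvg_sumr => y; apply: cvg_sumr => z; apply: cvgMr_tmp; exact: cw.
  apply: cvgn_pair; last by rewrite (_ : m2 = m1)//; exact/funext.
  by apply: cvgn_pair => //; exact: cvg_fspace.
- exists (u2, x.1.1); split; first exact: saddle_dual_solution sad2.
  apply: cvgn_pair.
    by rewrite -(cvg_shiftS u); exact: cvg_fspace.
  by rewrite [x.1.1]surjective_pairing; apply: cvgn_pair; exact: cvg_fspace.
Unshelve. all: by end_near. Qed.
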